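(* Let $J\ge2$, let $\beta\in(0,1)^J$ with $\sum_i\beta_i=1$, and let $\Gamma$ and $\pi$ be the GPS Skorokhod map and the GPS projection operator associated with $\beta$. Given $\nu\in\mathbb R^J$ and $\bar u\in\mathbb R_+^J$, let $\kappa=\pi(\nu)$, $\overline U=\Gamma(\bar u+\nu\iota)$, and let $\mathcal S(\nu)$ and $\mathcal M(\nu)$ be as defined in the context. Then: (i) If $\bar u\in\mathcal M(\nu)$, then $\overline U(t)=\bar u+\kappa t\in\mathcal M(\nu)$ for all $t\in(0,\infty)$. (ii) Given any compact set $G\subset\mathbb R_+^J$, there exists $T=T(G)<\infty$ such that for every $\bar u\in G$, $\overline U(t)\in\mathcal M(\nu)$ for all $t\ge T$. (iii) There exists $\bar u\in\mathcal M(\nu)$ such that $\overline U_i(t)>0$ for every $t\in(0,\infty)$ and $i\in\mathcal I\setminus\mathcal S(\nu)$. (iv) When $\sum_{j\in\mathcal I}\nu_j\le0$, $\mathcal M(\nu)$ admits the equivalent representation $$\mathcal M(\nu)=\{\bar u\in\mathbb R_+^J:\Gamma(\bar u+\nu\iota)(t)=\bar u\text{ for all }t\in[0,\infty)\}.$$ (v) Suppose the classes are ordered so that $\frac{\nu_1}{\beta_1}\ge\frac{\nu_2}{\beta_2}\ge\dots\ge\frac{\nu_J}{\beta_J}$. If $\sum_{j\in\mathcal I}\nu_j=0$ and $\min_{j\in\mathcal I}\nu_j<0$, then there exists $j_*\in\mathcal I$ such that $$\frac{\nu_j}{\beta_j}=\frac{\nu_1}{\beta_1}\ \text{ for } j<j_*\qquad\text{and}\qquad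 \mathcal S(\nu)=\Big\{j\in\mathcal I:\frac{\nu_j}{\beta_j}<\frac{\nu_1}{\beta_1}\Big\}.$$ Also, $$\nu_j=\frac{-\beta_j\big(\sum_{k\in\mathcal S(\nu)}\nu_k\big)}{1-\sum_{k\in\mathcal S(\nu)}\beta_k}\qquad\text{for } j\notin\mathcal S(\nu).$$
   Context: $\mathcal I=\{1,\dots,J\}$; $\iota(t)=t$; $e_i$ standard basis of $\mathbb R^J$; $\mathcal D([0,\infty):\mathbb R^J)$ is the space of right-continuous functions with left limits; $|\eta|(t)$ is total variation on $[0,t]$. **Directions of constraint.** $d_{J+1}=\sum_{i\in\mathcal I}e_i/\sqrt J$ and $d_i=e_i-\sum_{j\in\mathcal I\setminus\{i\}}\frac{\beta_j}{1-\beta_i}e_j$ for $i\in\mathcal I$. For $x\in\mathbb R_+^J$, let $I(x)=\{i\in\mathcal I:x_i=0\}$ if $x\neq0$, $I(0)=\mathcal I\cup\{J+1\}$, and $d(x)=\{\sum_{i\in I(x)}a_id_i:a_i\ge0\}$. **GPS Skorokhod problem (SP).** For $\psi\in\mathcal D([0,\infty):\mathbb R^J)$ with $\psi(0)\in\mathbb R_+^J$, $(\varphi,\eta)$ solves the SP for $\psi$ if $\varphi(0)=\psi(0)$ and for all $t\ge0$: $\varphi(t)=\psi(t)+\eta(t)$; $\varphi(t)\in\mathbb R_+^J$; $|\eta|(t)<\infty$; $|\eta|(t)=\int_{[0,t]}1_{\{\varphi(s)\in\partial\mathbb R_+^J\}}d|\eta|(s)$; and there is a measurable $g:[0,\infty)\to\mathbb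 R^J$ with $g(s)\in d(\varphi(s))$, $|g(s)|=1$ for $d|\eta|$-a.e. $s$, and $\eta(t)=\int_{[0,t]}g(s)\,d|\eta|(s)$. Solutions are unique, and exist for affine $\psi$; the GPS Skorokhod map is $\Gamma(\psi)=\varphi$. **Projection.** $\pi:\mathbb R^J\to\mathbb R_+^J$ is the (well-defined) map characterized by $\pi(x)=x$ if $x\in\mathbb R_+^J$, and $\pi(x)\in\partial\mathbb R_+^J$, $\pi(x)-x\in d(\pi(x))$ if $x\notin\mathbb R_+^J$. **$\mathcal S(\nu)$ and $\mathcal M(\nu)$.** If $\sum_j\nu_j\ge0$, there is a unique $\theta\in\mathbb R_+^{J+1}$ with $\pi(\nu)=\nu+\sum_{k=1}^{J+1}\theta_kd_k$ and $\mathcal I\ne\{k\in\mathcal I:\theta_k>0\}\subseteq\{k\in\mathcal I:\pi(\nu)_k=0\}$; put $\mathcal S_0(\nu)=\{j\in\mathcal I:\theta_j>0\}$. Define $\mathcal S(\nu)=\mathcal I$ if $\sum_j\nu_j<0$ and $\mathcal S(\nu)=\mathcal S_0(\nu)$ if $\sum_j\nu_j\ge0$. Finally $\mathcal M(\nu)=\{x\in\mathbb R_+^J:x_i=0\text{ for every }i\in\mathcal S(\nu)\}$. *)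

(* Defs.v *)
From HB Require Import structures.
From mathcomp Require Import all_boot all_order all_algebra.
From mathcomp Require Import all_classical all_reals all_analysis.

Set Implicit Arguments.
Unset Strict Implicit.
Unset Printing Implicit Defensive.

Import Order.TTheory GRing.Theory Num.Theory.
Import numFieldNormedType.Exports.

Local Open Scope classical_set_scope.
Local Open Scope ring_scope.

(** Vectors of R^J are row vectors [x : 'rV[R]_J] with coordinates [x 0 i].
    Functions on [0, oo) are functions on [R] of which only the values at
    nonnegative times are constrained. *)

Section GPS.
Variables (R : realType) (J : nat).
Implicit Types (beta nu x y v : 'rV[R]_J) (psi phi eta g : R -> 'rV[R]_J).

(** The canonical norm of ['rV[R]_J] is the sup norm. *)
Definition enorm x : R := Num.sqrt (\sum_i x 0 i ^+ 2).

Definition cadlag psi : Prop :=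
  (forall t : R, 0 <= t -> psi @ t^'+ --> psi t) /\
  (forall t : R, 0 < t -> cvg (psi @ t^'-)).

Definition variation_along eta (a b : R) (s : seq R) : R :=
  let F := eta \o nth b (a :: s) in
  \sum_(0 <= n < size s) enorm (F n.+1 - F n).

Definition tvar eta (t : R) : \bar R :=
  ereal_sup [set (variation_along eta 0 t s)%:E | s in itv_partition 0 t].

Definition orthant : set 'rV[R]_J := [set x | forall i, 0 <= x 0 i].

Definition bd_orthant : set 'rV[R]_J := closure orthant `\` orthant°.

(** Directions of constraint are indexed by [option 'I_J]: [Some i] stands for
    the class [i], and [None] for the extra index [J + 1]. *)
Definition dir beta (k : option 'I_J) : 'rV[R]_J :=
  match k with
  | Some i => delta_mx 0 i -
      \sum_(j | j != i) (beta 0 j / (1 - beta 0 i)) *: delta_mx 0 j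
  | None => \sum_i (Num.sqrt J%:R)^-1 *: delta_mx 0 i
  end.

Definition active x : set (option 'I_J) :=
  if x == 0 then setT else Some @` [set i | x 0 i = 0].

Definition dcone beta x : set 'rV[R]_J :=
  [set v | exists2 a : option 'I_J -> R, (forall k, 0 <= a k) &
    v = \sum_(k in active x) a k *: dir beta k].

(** [F] is the function [t |-> |eta|(t)] extended by 0 to negative times, so
    that [lebesgue_stieltjes_measure F] is the measure [d|eta|]. *)
Definition is_tvar_fun eta (F : R -> R) : Prop :=
  (forall t : R, t < 0 -> F t = 0) /\ (forall t : R, 0 <= t -> (F t)%:E = tvar eta t).

Record skorokhod_problem beta psi phi eta : Prop := {
  sp_cadlag : cadlag psi ;
  sp_dom : orthant (psi 0) ;
  sp_init : phi 0 = psi 0 ;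
  sp_decomp : forall t : R, 0 <= t -> phi t = psi t + eta t ;
  sp_orthant : forall t : R, 0 <= t -> orthant (phi t) ;
  sp_fin : forall t : R, 0 <= t -> (tvar eta t < +oo)%E ;
  sp_constraint : exists2 F : cumulative R R, is_tvar_fun eta F &
    let mu := lebesgue_stieltjes_measure F in
    (forall t : R, 0 <= t ->
       tvar eta t =
       (\int[mu]_(s in `[0%R, t]) (\1_(phi @^-1` bd_orthant) s)%:E)%E) /\
    exists g, [/\
      forall i, measurable_fun (`[0, +oo[ : set R) (fun s : R => g s 0 i),
      {ae mu, forall s : R, 0 <= s -> dcone beta (phi s) (g s) /\ enorm (g s) = 1} &
      forall t : R, 0 <= t -> forall i,
        (eta t 0 i)%:E = (\int[mu]_(s in `[0%R, t]) (g s 0 i)%:E)%E] }.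

(** The first component of the solution for [psi]; a default value when the
    problem has no solution. *)
Definition GPS_map beta psi : R -> 'rV[R]_J :=
  xget (cst 0) [set phi | exists eta, skorokhod_problem beta psi phi eta].

Definition GPS_proj beta x : 'rV[R]_J :=
  xget 0 [set y | (orthant x -> y = x) /\
                  (~ orthant x -> bd_orthant y /\ dcone beta y (y - x))].

Definition pos_classes (theta : {ffun option 'I_J -> R}) : set 'I_J :=
  [set i | 0 < theta (Some i)].

Definition theta_of beta nu : {ffun option 'I_J -> R} :=
  xget [ffun=> 0] [set theta : {ffun option 'I_J -> R} |
    [/\ forall k, 0 <= theta k,
        GPS_proj beta nu = nu + \sum_k theta k *: dir beta k,
        pos_classes theta <> setT &
        pos_classes theta `<=` [set i | GPS_proj beta nu 0 i = 0]]].

Definition calS beta nu : set 'I_J :=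
  if \sum_j nu 0 j < 0 then setT else pos_classes (theta_of beta nu).

Definition calM beta nu : set 'rV[R]_J :=
  [set x | orthant x /\ forall i, calS beta nu i -> x 0 i = 0].

(** [GPS_map beta (ubar + nu iota)], where [iota t = t]. *)
Definition fluid beta nu (ubar : 'rV[R]_J) : R -> 'rV[R]_J :=
  GPS_map beta (fun t => ubar + t *: nu).

End GPS.

(* Main.v *)
(** For an affine input the Skorokhod map is a static projection:
    Gamma(ubar + nu iota)(t) = pi(ubar + t nu).  When the coordinates of x have
    a nonnegative sum, pi(x) has coordinates (x_i - beta_i lambda(x))^+ with
    lambda(x) = max_A - x(A) / (1 - beta(A)) over the proper subsets A of the
    classes.  The path pi(ubar + t nu) solves the Skorokhod problem because
    lambda is convex: a class that has emptied has from then on a decreasing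
    excess x_i - beta_i lambda, and stays empty.  For uniqueness, the sum of the
    coordinates is a one-dimensional reflection, hence the same for any two
    solutions; their difference z then has sum zero, and sum_i z_i^2 / beta_i
    cannot grow, since on vectors of sum zero d(x) lies in the normal cone of the
    orthant for the inner product sum_i z_i w_i / beta_i.  All five assertions
    can then be read off the formula for pi, with
    S(nu) = {i | nu_i < beta_i lambda(nu)} when sum_j nu_j >= 0. *)

Require Import Defs.
From HB Require Import structures.
From mathcomp Require Import all_boot all_order all_algebra.
From mathcomp Require Import all_classical all_reals all_analysis.
From mathcomp Require Import measurable_realfun ring lra.
Import Order.TTheory GRing.Theory Num.Theory.
Import numFieldNormedType.Exports.
Local Open Scope classical_set_scope.
Local Open Scope ring_scope.

Set Implicit Arguments.
Unset Strict Implicit.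
Unset Printing Implicit Defensive.

(** Everything rests on [d_i = (e_i - beta) / (1 - beta_i)]. With [b_i = a_i / (1 - beta_i)],
    pushing along the [d_i] displaces coordinate j by [b_j - beta_j B], where [B] is the sum of the
    [b_i]; lambda is this total push. The weights 1 / beta_j of the inner product have the same
    origin: against z of sum zero, [e_i - beta] pairs to [z_i / beta_i], whose sign is known for a
    class that is empty in one of two solutions. The obstacle is regularity. A solution is only of
    bounded variation, may jump, and is driven by its own measure, so no chain rule is at hand.
    Quadratic forms of a difference are controlled by one-step estimates with a second-order error,
    propagated by induction along the half-line. Conversely, the candidate path needs its total
    variation, the measure of it and a unit direction; these are computed on short affine segments,
    as the path is built from affine functions by sums and maxima. Since the map, the projection and
    theta are all picked by [xget], each needs existence together with uniqueness (for theta, of its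
    set of positive classes). *)

Lemma big_option (V : nmodType) (T : finType) (f : option T -> V) :
  \sum_k f k = f None + \sum_i f (Some i).
Proof.
rewrite (bigD1 None)//=; congr (_ + _); rewrite (reindex_omap Some id) => [|[]]//=.
by apply: eq_bigl => i; rewrite eqxx.
Qed.

(** * The cones of constraint directions *)

Section Cones.
Variables (R : realType) (J : nat) (beta : 'rV[R]_J).
Hypothesis beta_01 : forall i, 0 < beta 0 i < 1.
Hypothesis beta_sum : \sum_i beta 0 i = 1.
Implicit Types (x y u v w : 'rV[R]_J) (i j : 'I_J).

Let b0 i : 0 < beta 0 i. Proof. by have /andP[] := beta_01 i. Qed.
Let b1 i : 0 < 1 - beta 0 i. Proof. by have /andP[_] := beta_01 i; rewrite subr_gt0. Qed.

Lemma classes_gt0 : (0 < J)%N.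
Proof.
rewrite lt0n; apply/eqP => J0; have := beta_sum.
rewrite big1 => [/esym/eqP|i]; first by rewrite oner_eq0.
by case: i => k ki; exfalso; move: ki; rewrite J0.
Qed.

Lemma dir_sumE (a : option 'I_J -> R) j :
  (\sum_k a k *: dir beta k) 0 j = a (Some j) / (1 - beta 0 j)
    - beta 0 j * \sum_i a (Some i) / (1 - beta 0 i) + a None / Num.sqrt J%:R.
Proof.
rewrite summxE big_option addrC; congr (_ + _); last first.
  rewrite !mxE summxE (bigD1 j)//= big1 => [|i /negbTE ij]; rewrite !mxE eqxx/=.
    by rewrite eqxx mulr1 addr0.
  by rewrite eq_sym ij mulr0.
under eq_bigr => i _.
  rewrite (_ : (a (Some i) *: dir beta (Some i)) 0 j =
     a (Some i) / (1 - beta 0 i) * (j == i)%:R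
       - beta 0 j * (a (Some i) / (1 - beta 0 i))); last first.
    rewrite !mxE summxE /=; have [->|ji] := eqVneq j i.
      rewrite big1 => [|k ki]; last by rewrite !mxE eqxx/= eq_sym (negbTE ki) mulr0.
      have := b1 i; set u := beta 0 i => u1; rewrite !mulr1n; by field; rewrite gt_eqF.
    rewrite (bigD1 j)//= big1 => [|k /andP[_ kj]].
      by rewrite !mxE !eqxx/= mulr1 addr0 mulr0 !sub0r mulrN mulrCA.
    by rewrite !mxE eqxx/= eq_sym (negbTE kj) mulr0.
  over.
rewrite sumrB -mulr_sumr (bigD1 j)//= eqxx mulr1 big1 ?addr0// => i /negbTE ij.
by rewrite eq_sym ij mulr0.
Qed.

(** [dcone] with the coefficients eliminated. Off the origin v has coordinates [b_j - beta_j B] with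
    b supported on the zeros of x, so [v_j / beta_j] takes its minimum [- B] wherever x is positive.
    At the origin the extra direction opens up the whole half-space of nonnegative sum. *)
Definition cone x v : Prop :=
  if x == 0 then is_true (0 <= \sum_j v 0 j)
  else \sum_j v 0 j = 0 /\
       forall i j, x 0 i != 0 -> v 0 i / beta 0 i <= v 0 j / beta 0 j.

Lemma row_sum_eq0 x : orthant x -> \sum_j x 0 j = 0 -> x = 0.
Proof.
move=> x0 /eqP; rewrite psumr_eq0// => /allP xe; apply/rowP => i; rewrite mxE.
by apply/eqP; apply: xe; rewrite mem_index_enum.
Qed.

Lemma row_neq0 x : x != 0 -> exists i, x 0 i != 0.
Proof.
move=> x0; apply: contrapT => xi; move/negP: x0; apply; apply/eqP/rowP => i.
by rewrite mxE; apply/eqP/negPn/negP => xi0; apply: xi; exists i.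
Qed.

Let sJ0 : 0 < Num.sqrt (J%:R : R).
Proof. by rewrite sqrtr_gt0 ltr0n classes_gt0. Qed.

Lemma sum_shift (f : 'I_J -> R) B c :
  \sum_j (f j - beta 0 j * B + c) = \sum_j f j - B + c *+ J.
Proof.
by rewrite big_split sumrB/= -mulr_suml beta_sum mul1r sumr_const card_ord.
Qed.

Lemma dconeP x v : dcone beta x v <-> cone x v.
Proof.
split=> [[a a0 ->]|].
- rewrite big_mkcond/=.
  pose a' k := if k \in active x then a k else 0.
  rewrite (_ : \sum_i _ = \sum_k a' k *: dir beta k); last first.
    by apply: eq_bigr => k _; rewrite /a'; case: ifP => //; rewrite scale0r.
  have a'0 k : 0 <= a' k by rewrite /a'; case: ifP.
  set s := \sum_k _ ; have sE j : s 0 j = _ := dir_sumE a' j.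
  set B := \sum_i a' (Some i) / (1 - beta 0 i) in sE.
  rewrite /cone; under eq_bigr do rewrite sE.
  rewrite sum_shift -/B subrr add0r; case: ifPn => x0.
    by rewrite mulrn_wge0// divr_ge0// ltW.
  have aN : a' None = 0.
    by rewrite /a' /active (negbTE x0) ifF//; apply/negbTE/negP; rewrite inE => -[].
  have ai i : x 0 i != 0 -> a' (Some i) = 0.
    rewrite /a' /active (negbTE x0) => xi; rewrite ifF//; apply/negbTE/negP.
    by rewrite inE => -[k /= xk [ki]]; move: xi; rewrite -ki xk eqxx.
  rewrite aN mul0r mul0rn; split=> // i j xi; rewrite !sE aN ai// !mul0r !addr0 sub0r.
  rewrite mulrDl !mulNr ![beta 0 _ * B / _]mulrAC !divff ?gt_eqF// !mul1r lerDr.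
  by rewrite !divr_ge0// ltW.
- rewrite /cone; case: ifPn => x0 => [v0|[v0 vm]].
    (* [c] is the share of the extra direction. The rest [w] has sum zero, so the [b j] add up to
       [B] for every [B]; this one is large enough to make them nonnegative. *)
    pose c := (\sum_j v 0 j) / J%:R; pose w j := v 0 j - c.
    have J0 : (J%:R : R) != 0 by rewrite pnatr_eq0 -lt0n classes_gt0.
    pose B := \sum_i `|w i| / beta 0 i; pose b j := w j + beta 0 j * B.
    have bB : \sum_j b j = B.
      rewrite /b big_split/= -mulr_suml beta_sum mul1r /w sumrB sumr_const card_ord.
      by rewrite /c -[_ / _ *+ _]mulr_natr divfK// subrr add0r.
    exists (fun k => if k is Some i then (1 - beta 0 i) * b i else Num.sqrt J%:R * c).
      move=> [i|]; rewrite mulr_ge0//; first by rewrite ltW.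
        rewrite /b /B (bigD1 i)//= mulrDr mulrCA divff ?gt_eqF// mulr1 addrA addr_ge0//.
          by rewrite -lerBlDl sub0r ler_normr lexx orbT.
        by rewrite mulr_ge0 ?(ltW (b0 _))// sumr_ge0// => k _; rewrite divr_ge0// ltW.
      by rewrite /c divr_ge0.
    rewrite /active x0 (eq_bigl xpredT); last by move=> k; rewrite in_setT.
    apply/rowP => j; rewrite dir_sumE mulrAC divff ?gt_eqF// mul1r.
    under eq_bigr do rewrite mulrAC divff ?gt_eqF// mul1r.
    rewrite bB mulrAC divff ?gt_eqF// mul1r /b /w; ring.
  (* Here [B] is forced: b has to vanish where x is positive, so [B] is minus the common ratio
     there. *)
  have [i0 xi0] := row_neq0 x0; pose B := - (v 0 i0 / beta 0 i0).
  pose b j := v 0 j + beta 0 j * B.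
  have bE j : b j = beta 0 j * (v 0 j / beta 0 j - v 0 i0 / beta 0 i0).
    by rewrite /b /B mulrDr mulrCA divff ?gt_eqF// mulr1.
  have bB : \sum_j b j = B.
    by rewrite /b big_split/= -mulr_suml beta_sum mul1r v0 add0r.
  have b_ge0 j : 0 <= b j by rewrite bE mulr_ge0 ?(ltW (b0 _))// subr_ge0 vm.
  have bx j : x 0 j != 0 -> b j = 0.
    move=> xj; rewrite bE (_ : _ - _ = 0) ?mulr0//.
    by apply/eqP; rewrite subr_eq0 eq_le !vm.
  exists (fun k => if k is Some i then (1 - beta 0 i) * b i else 0).
    by move=> [i|]//; rewrite mulr_ge0// ltW.
  rewrite big_mkcond/=.
  rewrite (_ : \sum_i _ =
      \sum_k (if k is Some i then (1 - beta 0 i) * b i else 0) *: dir beta k).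
    apply/rowP => j; rewrite dir_sumE mulrAC divff ?gt_eqF// mul1r.
    under eq_bigr do rewrite mulrAC divff ?gt_eqF// mul1r.
    by rewrite bB mul0r addr0 /b addrK.
  apply: eq_bigr => -[i|] _; last by rewrite scale0r if_same.
  case: ifPn => //; rewrite /active (negbTE x0) notin_setE/= => ni.
  rewrite bx ?mulr0 ?scale0r//; apply/eqP => xi; apply: ni; exists i => //.
Qed.

(** Only at the origin does the cone leave the hyperplane of sum zero, and there x has the smallest
    sum possible. This is the monotonicity of one-dimensional reflection. *)
Lemma cone_sum_le x y v : orthant y -> cone x v ->
  (\sum_j x 0 j - \sum_j y 0 j) * \sum_j v 0 j <= 0.
Proof.
move=> y0; rewrite /cone; case: eqP => [-> v0|_ [-> _]]; last by rewrite mulr0.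
rewrite big1 => [|j _]; last by rewrite mxE.
by rewrite sub0r mulNr oppr_le0 mulr_ge0// sumr_ge0.
Qed.

(** As [x - y] has sum zero, a constant may be subtracted from the ratios [v_j / beta_j]. With their
    minimum subtracted, the terms with [x_j] positive vanish and the others are [- y_j] times a
    nonnegative number. *)
Lemma cone_form_le x y v : orthant x -> orthant y ->
  \sum_j x 0 j = \sum_j y 0 j -> cone x v ->
  \sum_j (x 0 j - y 0 j) * v 0 j / beta 0 j <= 0.
Proof.
move=> x0 y0 xy; rewrite /cone; case: eqP => [xe|/eqP xn0 [_ vm]].
  move: xy; rewrite xe big1 => [/esym/(row_sum_eq0 y0)->|j _]; last by rewrite mxE.
  by move=> _; apply: sumr_le0 => j _; rewrite !mxE subrr !mul0r.
have [i0 xi0] := row_neq0 xn0; pose m := v 0 i0 / beta 0 i0.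
have -> : \sum_j (x 0 j - y 0 j) * v 0 j / beta 0 j =
          \sum_j (x 0 j - y 0 j) * (v 0 j / beta 0 j - m).
  under [RHS]eq_bigr do rewrite mulrBr mulrA.
  by rewrite sumrB -mulr_suml sumrB xy subrr mul0r subr0.
apply: sumr_le0 => j _; have [xj|xj] := eqVneq (x 0 j) 0.
  by rewrite xj sub0r mulNr oppr_le0 mulr_ge0// subr_ge0 vm.
by rewrite (_ : _ - m = 0) ?mulr0//; apply/eqP; rewrite subr_eq0 eq_le !vm.
Qed.

Lemma form_eq0 (z : 'I_J -> R) : \sum_j z j * z j / beta 0 j <= 0 -> forall j, z j = 0.
Proof.
move=> z0 j; have t0 k : 0 <= z k * z k / beta 0 k.
  by rewrite divr_ge0 ?(ltW (b0 _))// -expr2 sqr_ge0.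
have /eqP : \sum_j z j * z j / beta 0 j = 0 by apply/eqP; rewrite eq_le z0 sumr_ge0.
rewrite psumr_eq0// => /allP/(_ j (mem_index_enum _)).
by rewrite !mulf_eq0 invr_eq0 (gt_eqF (b0 j)) orbF orbb => /eqP.
Qed.

(** Two variational inequalities, each tested at the other point, add up to a square: first for the
    sums of coordinates and, once these agree, for the form weighted by [1 / beta]. *)
Lemma cone_unique x u w : orthant u -> orthant w ->
  cone u (u - x) -> cone w (w - x) -> u = w.
Proof.
move=> u0 w0 cu cw.
have S y : \sum_j (y - x) 0 j = \sum_j y 0 j - \sum_j x 0 j.
  by rewrite -sumrB; apply: eq_bigr => j _; rewrite !mxE.
have uw : \sum_j u 0 j = \sum_j w 0 j.
  have := cone_sum_le w0 cu; have := cone_sum_le u0 cw; rewrite !S.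
  by move=> h1 h2; nra.
have := cone_form_le u0 w0 uw cu; have := cone_form_le w0 u0 (esym uw) cw.
move=> h1 h2; apply/rowP => j; apply/eqP; rewrite -subr_eq0; apply/eqP.
apply: (form_eq0 (z := fun j => u 0 j - w 0 j)).
have h := lerD h1 h2; rewrite addr0 in h; apply: le_trans h.
rewrite -big_split/= ler_sum// => k _; rewrite !mxE.
by have /eqP -> : (u 0 k - w 0 k) * (u 0 k - w 0 k) / beta 0 k ==
 (w 0 k - u 0 k) * (w 0 k - x 0 k) / beta 0 k + (u 0 k - w 0 k) * (u 0 k - x 0 k) / beta 0 k
  by apply/eqP; ring.
Qed.

End Cones.

(** * The projection *)

Section Projection.
Variables (R : realType) (J : nat) (beta : 'rV[R]_J).
Hypothesis beta_01 : forall i, 0 < beta 0 i < 1.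
Hypothesis beta_sum : \sum_i beta 0 i = 1.
Implicit Types (x y u v w : 'rV[R]_J) (i j : 'I_J) (A : {set 'I_J}).

Let b0 i : 0 < beta 0 i. Proof. by have /andP[] := beta_01 i. Qed.

(* The solution of lambda = sum_i (beta_i lambda - x_i)^+: this asks that lambda
   dominate sum_(i in A) (beta_i lambda - x_i) for all A, with equality for one
   of them, and each of these inequalities is solved for lambda. *)
Definition lam x : R :=
  \big[Num.max/0]_(A : {set 'I_J} | [exists i, i \notin A])
    (- (\sum_(i in A) x 0 i) / (1 - \sum_(i in A) beta 0 i)).

Lemma proper_massE A : 1 - \sum_(i in A) beta 0 i = \sum_(i | i \notin A) beta 0 i.
Proof. by rewrite -beta_sum (bigID (fun i => i \in A))/= addrAC subrr add0r. Qed.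

Lemma proper_mass A : [exists i, i \notin A] -> 0 < 1 - \sum_(i in A) beta 0 i.
Proof.
move=> /existsP[i iA]; rewrite proper_massE.
by rewrite (bigD1 i)//= ltr_pwDl ?sumr_ge0// => j _; rewrite ltW.
Qed.

Lemma lam_ge A x : [exists i, i \notin A] ->
  - (\sum_(i in A) x 0 i) <= lam x * (1 - \sum_(i in A) beta 0 i).
Proof.
move=> nA; rewrite -ler_pdivrMr ?proper_mass//.
exact: (le_bigmax_cond 0
  (fun A => - (\sum_(i in A) x 0 i) / (1 - \sum_(i in A) beta 0 i))).
Qed.

(** The starting value 0 of the maximum is itself the term of the empty set, which is proper because
    there is at least one class. *)
Lemma lam_attained x : exists2 A : {set 'I_J}, [exists i, i \notin A] &
  lam x * (1 - \sum_(i in A) beta 0 i) = - (\sum_(i in A) x 0 i).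
Proof.
suff [A nA ->] : exists2 A : {set 'I_J}, [exists i, i \notin A] &
    lam x = - (\sum_(i in A) x 0 i) / (1 - \sum_(i in A) beta 0 i).
  by exists A => //; rewrite divfK// gt_eqF ?proper_mass.
rewrite /lam; apply: (big_ind (fun r => exists2 A : {set 'I_J}, [exists i, i \notin A] &
    r = - (\sum_(i in A) x 0 i) / (1 - \sum_(i in A) beta 0 i))).
- exists finset.set0; last by rewrite !big_set0 oppr0 mul0r.
  by apply/existsP; exists (Ordinal (classes_gt0 beta_sum)); rewrite finset.inE.
- by move=> r s [A nA rA] [B nB sB]; rewrite /Num.max; case: ifP => _; [exists B|exists A].
- by move=> A nA; exists A.
Qed.

Lemma lam_ge0 x : 0 <= lam x. Proof. exact: bigmax_ge_id. Qed.

Lemma sum_notin_lam A x :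
  \sum_(i | i \notin A) (x 0 i - beta 0 i * lam x) =
  \sum_i x 0 i - \sum_(i in A) x 0 i - lam x * (1 - \sum_(i in A) beta 0 i).
Proof.
rewrite sumrB -mulr_suml -proper_massE [\sum_i x 0 i](bigID (fun i => i \in A))/=.
by ring.
Qed.

(** A set attaining [lam] makes the left side large enough; the set of classes with negative excess
    keeps it from being too large. If the latter contains every class, the left side is 0 and the
    sign of the sum decides. *)
Lemma lam_sum x : 0 <= \sum_i x 0 i ->
  \sum_i Num.max 0 (x 0 i - beta 0 i * lam x) = \sum_i x 0 i.
Proof.
move=> x0; apply/eqP; rewrite eq_le; apply/andP; split; last first.
  have [A nA lA] := lam_attained x.
  rewrite [leRHS](bigID (fun i => i \in A))/= -[leLHS]add0r lerD//.
    by apply: sumr_ge0 => i _; rewrite le_max lexx.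
  apply: le_trans (_ : \sum_(i | i \notin A) (x 0 i - beta 0 i * lam x) <= _).
    by rewrite sum_notin_lam lA; lra.
  by apply: ler_sum => i _; rewrite le_max lexx orbT.
pose A := [set i | x 0 i < beta 0 i * lam x]%SET.
rewrite (bigID (fun i => i \in A))/= big1 => [|i]; last first.
  by rewrite finset.inE => iA; apply/max_idPl; rewrite subr_le0 ltW.
rewrite add0r (eq_bigr (fun i => x 0 i - beta 0 i * lam x)) => [|i]; last first.
  by rewrite finset.inE -leNgt => iA; apply/max_idPr; rewrite subr_ge0.
have [nA|] := boolP [exists i, i \notin A].
  by rewrite sum_notin_lam; have := lam_ge x nA; lra.
by move=> /existsPn nA; rewrite big_pred0// => i; apply/negbTE/nA.
Qed.

(* A point of negative sum projects to 0; moving it along beta to the hyperplane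
   of sum zero first makes a single formula cover both cases. *)
Definition nonneg_shift x : 'rV[R]_J := x + Num.max 0 (- \sum_i x 0 i) *: beta.

Lemma nonneg_shift_sum x : \sum_i nonneg_shift x 0 i = Num.max 0 (\sum_i x 0 i).
Proof.
under eq_bigr do rewrite !mxE; rewrite big_split/= -mulr_sumr beta_sum mulr1.
by rewrite addr_maxr addr0 subrr maxC.
Qed.

Lemma nonneg_shift_id x : 0 <= \sum_i x 0 i -> nonneg_shift x = x.
Proof. by move=> x0; rewrite /nonneg_shift max_l ?oppr_le0// scale0r addr0. Qed.

Definition gps_proj x : 'rV[R]_J :=
  \row_i Num.max 0 (nonneg_shift x 0 i - beta 0 i * lam (nonneg_shift x)).

Lemma gps_proj_orthant x : orthant (gps_proj x).
Proof. by move=> i; rewrite mxE le_max lexx. Qed.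

Lemma gps_proj_sum x : \sum_i gps_proj x 0 i = Num.max 0 (\sum_i x 0 i).
Proof.
rewrite -nonneg_shift_sum; under eq_bigr do rewrite mxE.
by apply: lam_sum; rewrite nonneg_shift_sum le_max lexx.
Qed.

(** Away from the origin, a coordinate that stays positive moves by exactly [- beta_i lam] and has
    ratio [- lam]; truncation at 0 can only raise the other ratios. *)
Lemma gps_proj_cone x : cone beta (gps_proj x) (gps_proj x - x).
Proof.
have S : \sum_j (gps_proj x - x) 0 j = Num.max 0 (\sum_i x 0 i) - \sum_j x 0 j.
  by rewrite -gps_proj_sum -sumrB; apply: eq_bigr => j _; rewrite !mxE.
rewrite /cone S; case: ifPn => p0; first by rewrite subr_ge0 le_max lexx orbT.
have x0 : 0 < \sum_j x 0 j.
  rewrite ltNge; apply: contra p0 => x0; apply/eqP/row_sum_eq0.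
    exact: gps_proj_orthant.
  by rewrite gps_proj_sum; apply/max_idPl.
rewrite (max_r (ltW x0)) subrr; split=> // i j.
rewrite /gps_proj (nonneg_shift_id (ltW x0)) !mxE => pi0.
have -> : Num.max 0 (x 0 i - beta 0 i * lam x) = x 0 i - beta 0 i * lam x.
  by apply/max_idPr; rewrite leNgt; apply: contra pi0 => h; rewrite max_l// ltW.
have -> : (x 0 i - beta 0 i * lam x - x 0 i) / beta 0 i = - lam x.
  by field; rewrite gt_eqF.
rewrite ler_pdivlMr// lerBrDr le_max; apply/orP; right; lra.
Qed.

Lemma gps_projP x u : orthant u -> cone beta u (u - x) -> u = gps_proj x.
Proof.
move=> u0 cu; apply: (cone_unique beta_01 u0 (@gps_proj_orthant x) cu).
exact: gps_proj_cone.
Qed.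

Lemma cone0 x : cone beta x 0.
Proof.
rewrite /cone big1 ?lexx => [|j _]; last by rewrite mxE.
by case: ifP => // _; split=> // i j _; rewrite !mxE !mul0r.
Qed.

Lemma gps_proj_id x : orthant x -> gps_proj x = x.
Proof. by move=> x0; apply/esym/gps_projP => //; rewrite subrr; exact: cone0. Qed.

Lemma cone_interior x v : (forall i, 0 < x 0 i) -> cone beta x v -> v = 0.
Proof.
move=> x0; rewrite /cone ifF; last first.
  apply/negbTE/eqP => xe; have := x0 (Ordinal (classes_gt0 beta_sum)).
  by rewrite xe mxE ltxx.
(* All the ratios v_i / beta_i agree, and the v_i sum to zero. *)
move=> [v0 vm]; pose o := Ordinal (classes_gt0 beta_sum).
have vE j : v 0 j = beta 0 j * (v 0 o / beta 0 o).
  have -> : v 0 o / beta 0 o = v 0 j / beta 0 j by apply/eqP; rewrite eq_le !vm ?gt_eqF.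
  by rewrite mulrCA divff ?mulr1// gt_eqF.
have : v 0 o / beta 0 o = 0.
  by rewrite -v0 (eq_bigr _ (fun j _ => vE j)) -mulr_suml beta_sum mul1r.
by move=> vo; apply/rowP => j; rewrite vE vo mulr0 mxE.
Qed.

End Projection.

Section OrthantBoundary.
Variables (R : realType) (J : nat).
Implicit Types (x : 'rV[R]_J).

Lemma closed_orthant : closed (@orthant R J).
Proof.
have -> : @orthant R J = \bigcap_i ((fun x => x 0 i) @^-1` [set r | 0 <= r]).
  by apply/seteqP; split=> [x x0 i _|x x0 i]; [exact: x0|exact: (x0 i)].
apply: closed_bigI => i _; apply: closed_comp => [x _|]; last exact: closed_ge.
exact: coord_continuous.
Qed.

Lemma bd_orthantP x : bd_orthant x <-> orthant x /\ exists i, x 0 i = 0.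
Proof.
rewrite /bd_orthant /setD /= -(closure_id _).1; last exact: closed_orthant.
split=> -[x0 xi]; split=> //.
  apply: contrapT => nx; apply: xi.
  apply: (@filter_forall _ _ (fun i => [set y : 'rV[R]_J | 0 <= y 0 i])
    (nbhs x) (nbhs_filter x)) => i.
  have xi : 0 < x 0 i.
    by rewrite lt_neqAle x0 andbT eq_sym; apply/eqP => xi0; apply: nx; exists i.
  have cx : (fun y : 'rV[R]_J => y 0 i) y @[y --> x] --> x 0 i by exact: coord_continuous.
  by apply: filterS (cvgr_gt _ cx _ xi) => y /ltW.
move: xi => [i xi0] /nbhs_ballP[e /= e0 eb].
have := eb (x - (e / 2) *: delta_mx 0 i) _ i; rewrite !mxE !eqxx xi0 mulr1.
suff : ball x e (x - (e / 2) *: delta_mx 0 i) by move=> h /(_ h); lra.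
split=> [|k j]; first by lra.
rewrite /ball/= !mxE (ord1 k) opprB addrCA subrr addr0.
rewrite normrM (gtr0_norm (_ : 0 < e / 2)) ?divr_gt0//.
case: (_ && _); rewrite ?normr1 ?normr0; lra.
Qed.

End OrthantBoundary.

(** For a point outside the orthant the formula must be shown to land on the boundary: the cone at
    an interior point is trivial, so the point would not have moved at all. *)
Lemma GPS_projE (R : realType) (J : nat) (beta : 'rV[R]_J)
  (beta_01 : forall i, 0 < beta 0 i < 1) (beta_sum : \sum_i beta 0 i = 1) x :
  GPS_proj beta x = gps_proj beta x.
Proof.
rewrite /GPS_proj; case: xgetP => [y ->|none].
  move=> [y_id y_bd]; have [x0|nx0] := pselect (orthant x).
    by rewrite y_id// gps_proj_id.
  have [/bd_orthantP[y0 _] /(dconeP beta_01 beta_sum) yx] := y_bd nx0.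
  exact: gps_projP.
exfalso; apply: (none (gps_proj beta x)); split=> [x0|nx0]; first exact: gps_proj_id.
have cx := gps_proj_cone beta_01 beta_sum x.
have p0 := @gps_proj_orthant _ _ beta x.
split; last exact/dconeP.
apply/bd_orthantP; split=> //; apply: contrapT => ni; apply: nx0.
suff /eqP : gps_proj beta x - x = 0 by rewrite subr_eq0 => /eqP <-.
apply: cone_interior cx => // i; rewrite lt_neqAle p0 andbT eq_sym.
by apply/eqP => pi0; apply: ni; exists i.
Qed.

(** * Uniqueness *)

Section StieltjesMeasure.
Variable (R : realType).
Implicit Types (F : cumulative R R).
Notation lsm := lebesgue_stieltjes_measure.

Lemma lsm_oc F (a b : R) : a <= b -> lsm F `]a, b] = (F b - F a)%:E.
Proof.
move=> ab; rewrite /lebesgue_stieltjes_measure /measure_extension.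
rewrite measurable_mu_extE/=; last by exact: is_ocitv.
exact: wlength_itv_bnd.
Qed.

(** Continuity induction, by the supremum of the initial segments on which [P] holds. It stands in
    for partitions of [[0, t]], both for paths with jumps and for affine pieces. *)
Lemma real_induction (P : R -> Prop) :
  P 0 ->
  (forall t, 0 <= t -> P t -> exists2 e, 0 < e & forall s, t <= s <= t + e -> P s) ->
  (forall t, 0 < t -> (forall s, 0 <= s < t -> P s) -> P t) ->
  forall t, 0 <= t -> P t.
Proof.
move=> P0 Pr Pl T T0; apply: contrapT => nPT.
pose A := [set t | 0 <= t /\ forall s, 0 <= s <= t -> P s].
have A0 : A 0 by split => // s s0; have -> : s = 0 by lra.
have ubA : ubound A T.
  by move=> t [t0 Pt]; rewrite leNgt; apply/negP => tT; apply: nPT; apply: Pt; lra.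
have sA : has_sup A by split; [exists 0|exists T].
have s0 : 0 <= sup A by apply: ub_le_sup A0; exact: sA.2.
have Plt s : 0 <= s < sup A -> P s.
  move=> /andP[s_0 sl]; have e0 : 0 < sup A - s by lra.
  by have [t [t0 Pt] st] := sup_adherent e0 sA; apply: Pt; lra.
have Ps : P (sup A).
  have [<-//|s1] := eqVneq 0 (sup A).
  by apply: Pl => //; rewrite lt_neqAle s1.
have [e e0 Pe] := Pr _ s0 Ps.
suff Ae : A (sup A + e).
  by have := ub_le_sup sA.2 Ae; lra.
split; first by lra.
move=> s /andP[s_0 se]; have [|ss] := ltP s (sup A); last by apply: Pe; rewrite ss.
by move=> ss; apply: Plt; rewrite s_0.
Qed.

Lemma lsm_fin F (A : set R) (a b : R) : measurable A -> A `<=` `]a, b] ->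
  (lsm F A < +oo)%E.
Proof.
move=> mA Aab; apply: (@le_lt_trans _ _ (lsm F `]a, b])).
  by apply: le_measure; rewrite ?inE.
have [ab|ba] := leP a b; first by rewrite lsm_oc// ltry.
by rewrite set_itv_ge ?measure0// bnd_simp -leNgt ltW.
Qed.

(** The interval leaves out [t], so an atom there is not counted, and the sets []t - 1/(n+1), t[]
    decrease to the empty set. *)
Lemma lsm_left F (t e : R) : 0 < e ->
  exists2 d, 0 < d & (lsm F `](t - d)%R, t[ <= e%:E)%E.
Proof.
move=> e0.
have := @nonincreasing_cvg_mu _ _ _ (lsm F) (fun n => `]t - n.+1%:R^-1, t[%classic).
have -> : \bigcap_n `]t - n.+1%:R^-1, t[%classic = set0 :> set R.
  rewrite -subset0 => x xI.
  have xt : x < t by have := xI 0%N I; rewrite /= in_itv/= => /andP[].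
  have tx : 0 < t - x by lra.
  have [n nx] := ltr_add_invr tx.
  have := xI n I; rewrite /= in_itv/= => /andP[+ _].
  by move: nx; set u := _^-1; lra.
rewrite measure0 => H.
have {}H : (lsm F \o (fun n => `]t - n.+1%:R^-1, t[%classic)) x @[x --> \oo] --> 0%E.
  apply: H => //=.
  - apply: (@lsm_fin _ _ (t - 1) t) => //.
    by rewrite invr1; apply: subset_itvl; rewrite bnd_simp.
  - move=> m n mn; apply/subsetPset; apply: subset_itvr.
    by rewrite bnd_simp lerD2l lerN2 lef_pV2 ?posrE// ler_nat.
have /H[n _ Hn]: nbhs 0%E [set x : \bar R | (x < e%:E)%E].
  exact: (@nbhs_open_ereal_lt _ 0 (fun=> e)).
exists n.+1%:R^-1; first by rewrite invr_gt0.
apply: ltW; by apply: (Hn n) => /=.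
Qed.

End StieltjesMeasure.

(** * Paths obtained by integrating unit vectors against a Stieltjes measure *)

Section DrivenIncrements.
Variable (R : realType).
Notation lsm := lebesgue_stieltjes_measure.

Lemma enorm_coord J (v : 'rV[R]_J) i : `|v 0 i| <= enorm v.
Proof.
rewrite -sqrtr_sqr /enorm ler_sqrt; last by apply: sumr_ge0 => j _; exact: sqr_ge0.
by rewrite (bigD1 i)//= lerDl sumr_ge0// => j _; exact: sqr_ge0.
Qed.

Lemma ae_integral_le_indic (d : measure_display) (T : measurableType d)
    (mu : {measure set T -> \bar R}) (D B : set T) (f : T -> R) (K : R) :
  measurable D -> measurable B -> measurable_fun D f -> 0 <= K ->
  {ae mu, forall x, D x -> f x <= K * \1_B x} ->
  (\int[mu]_(x in D) (f x)%:E <= K%:E * mu (B `&` D))%E.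
Proof.
move=> mD mB mf K0 fB.
rewrite -integral_indic// -ge0_integralZl//; last first.
  by apply/measurable_EFinP; exact: measurable_indic.
rewrite integralE; apply: le_trans (_ : \int[mu]_(x in D) (fun x => (f x)%:E)^\+ x <= _)%E.
  by rewrite geeDl// oppe_le0; apply: integral_ge0.
apply: ae_ge0_le_integral => //.
- by apply: measurable_funepos; exact/measurable_EFinP.
- by move=> x _; rewrite -EFinM lee_fin mulr_ge0.
- by apply/measurable_EFinP/measurable_funM => //; exact: measurable_indic.
apply: filterS fB => x fx Dx; rewrite funeposE -EFinM ge_max !lee_fin fx//=.
by rewrite mulr_ge0.
Qed.

Variables (J : nat) (F : cumulative R R) (eta g : R -> 'rV[R]_J).
Variable C : R -> set 'rV[R]_J.
Hypothesis mg : forall i, measurable_fun (`[0, +oo[ : set R) (fun s : R => g s 0 i).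
Hypothesis gC : {ae lsm F, forall s : R, 0 <= s -> C s (g s) /\ enorm (g s) = 1}.
Hypothesis eta_int : forall t : R, 0 <= t -> forall i,
  (eta t 0 i)%:E = (\int[lsm F]_(s in `[0%R, t]) (g s 0 i)%:E)%E.

Lemma measurable_coordS i (D : set R) : D `<=` `[0, +oo[ ->
  measurable_fun D (fun s : R => g s 0 i).
Proof. by move=> D0; apply: measurable_funS (mg i). Qed.

Lemma cc_sub_pos (t : R) : `[0, t] `<=` (`[0, +oo[%classic : set R).
Proof. by apply: subset_itvl; rewrite bnd_simp. Qed.

Lemma oc_sub_pos (s t : R) : 0 <= s -> `]s, t] `<=` (`[0, +oo[%classic : set R).
Proof. by move=> s0; apply: subset_itv; rewrite bnd_simp. Qed.

Lemma driver_integrable i t : 0 <= t ->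
  (lsm F).-integrable `[0, t] (EFin \o (fun s : R => g s 0 i)).
Proof.
move=> t0; have mD : measurable_fun `[0, t] (fun s : R => g s 0 i).
  by apply: (@measurable_coordS i); exact: cc_sub_pos.
apply/integrableP; split; first exact/measurable_EFinP.
have H : (\int[lsm F]_(x in `[0%R, t]) (`|g x 0%R i|)%:E <=
    1%:E * lsm F (setT `&` `[0%R, t]))%E.
  apply: ae_integral_le_indic => //.
    exact: measurableT_comp.
  have aeF := ae_filter_ringOfSetsType (lsm F).
  apply: filterS gC => s gs; rewrite /= in_itv/= => /andP[s0 _].
  by rewrite indicT mulr1 -(gs s0).2 enorm_coord.
(* Starting the half-open interval at -1 includes 0, where the measure may have an atom. *)
apply: (le_lt_trans H); rewrite mul1e setTI; apply: (@lsm_fin _ _ _ (-1) t) => //.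
by apply: subset_itvr; rewrite bnd_simp; lra.
Qed.

Lemma driver_incr_int i s t : 0 <= s -> s <= t ->
  (eta t 0 i - eta s 0 i)%:E = (\int[lsm F]_(r in `]s, t]) (g r 0 i)%:E)%E.
Proof.
move=> s0 st; have t0 : 0 <= t by lra.
have E : `[0, t]%classic = `[0, s] `|` `]s, t] :> set R.
  by apply: itv_bndbnd_setU; rewrite bnd_simp.
have dE : [disjoint `[0, s] & `]s, t]]%classic.
  apply/disj_setPS => x /= []; rewrite !in_itv/=; lra.
rewrite EFinB !eta_int// E integral_setU//; last first.
  apply/measurable_EFinP; by rewrite -E; apply: (@measurable_coordS i); exact: cc_sub_pos.
rewrite addeAC subee ?add0e//.
by apply: integrable_fin_num => //; exact: driver_integrable.
Qed.

(** A bound on a linear functional over the unit vectors of [C r] passes to the increments of [eta].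
    The set [B] says which mass is charged: an open interval in the energy estimate, everything in
    the crude bound on coordinates. *)
Lemma driver_incr_le (c : 'I_J -> R) (B : set R) K s t : 0 <= s -> s <= t ->
  measurable B -> 0 <= K ->
  (forall r v, s < r <= t -> C r v -> enorm v = 1 -> \sum_i c i * v 0 i <= K * \1_B r) ->
  (\sum_i c i * (eta t 0 i - eta s 0 i) <= K * fine (lsm F (B `&` `]s, t])))%R.
Proof.
move=> s0 st mB K0 H; have t0 : 0 <= t by lra.
have sub : `]s, t] `<=` (`[0, t]%classic : set R).
  by apply: subset_itvr; rewrite bnd_simp.
have fi i : (lsm F).-integrable `]s, t] (EFin \o (fun r : R => g r 0 i)).
  by apply: integrableS (driver_integrable i t0).
rewrite -lee_fin EFinM fineK; last first.
  rewrite ge0_fin_numE//; apply: (@lsm_fin _ _ _ s t); last exact: subIsetr.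
  exact: measurableI.
have -> : ((\sum_i c i * (eta t 0 i - eta s 0 i))%:E =
   \int[lsm F]_(r in `]s, t]) (\sum_i c i * g r 0 i)%:E)%E.
  under [RHS]eq_integral do rewrite -sumEFin.
  rewrite integral_sum//=; last first.
    by move=> i; have := integrableZl _ (c i) (fi i); exact.
  rewrite -sumEFin; apply: eq_bigr => i _.
  rewrite EFinM driver_incr_int//.
  by rewrite -integralZl//; exact: fi.
apply: ae_integral_le_indic => //.
  apply: measurable_sum => i; apply: measurable_funM => //.
  by apply: measurable_coordS; exact: oc_sub_pos.
have aeF := ae_filter_ringOfSetsType (lsm F).
apply: filterS gC => r gr /=; rewrite in_itv/= => rst.
have r0 : 0 <= r by lra.
by have [? ?] := gr r0; exact: H.
Qed.

Lemma driver_incr_abs i s t : 0 <= s -> s <= t -> `|eta t 0 i - eta s 0 i| <= F t - F s.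
Proof.
move=> s0 st.
have H (e : R) : `|e| = 1 -> e * (eta t 0 i - eta s 0 i) <= F t - F s.
  move=> e1.
  have := @driver_incr_le (fun j => e * (j == i)%:R) setT 1 s t s0 st measurableT ler01.
  rewrite setTI lsm_oc//= mul1r => /(_ _) le.
  have S (v : 'I_J -> R) : \sum_j e * (j == i)%:R * v j = e * v i.
    by rewrite (bigD1 i)//= eqxx mulr1 big1 ?addr0// => j /negbTE ->; rewrite mulr0 mul0r.
  rewrite -(S (fun j => eta t 0 j - eta s 0 j)); apply: le => r v _ _ v1.
  rewrite (S (fun j => v 0 j)) indicT mul1r -v1.
  apply: le_trans (enorm_coord v i); apply: le_trans (ler_norm _) _.
  by rewrite normrM e1 mul1r.
rewrite ler_norml; have := H 1 (normr1 _); have := H (-1) (normrN1 _).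
by lra.
Qed.

End DrivenIncrements.

(** * Energy estimate for the difference of two driven paths *)

Section Uniqueness.
Variables (R : realType) (J : nat).
Notation lsm := lebesgue_stieltjes_measure.

(** Isolates the integral representation of [eta] from the Skorokhod problem, with an abstract
    family [C] of constraints on which only the sign of a linear functional will be known. *)
Definition driven (F : cumulative R R) (C : R -> set 'rV[R]_J) (eta : R -> 'rV[R]_J) :=
  exists g : R -> 'rV[R]_J, [/\
    forall i, measurable_fun (`[0, +oo[ : set R) (fun s : R => g s 0 i),
    {ae lsm F, forall s : R, 0 <= s -> C s (g s) /\ enorm (g s) = 1} &
    forall t : R, 0 <= t -> forall i,
      (eta t 0 i)%:E = (\int[lsm F]_(s in `[0%R, t]) (g s 0 i)%:E)%E].

(* [V] is a quadratic form on the difference of two solutions, and [c z] is half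
   its gradient. *)
Variable c : 'rV[R]_J -> 'I_J -> R.
Let V z := \sum_i c z i * z 0 i.
Variable K : R.
Hypothesis cB : forall z w i, c (z - w) i = c z i - c w i.
Hypothesis cK : forall (z : 'rV[R]_J) M (v : 'rV[R]_J), (forall i, `|z 0 i| <= M) ->
  (forall i, `|v 0 i| <= 1) -> \sum_i c z i * v 0 i <= K * M.
Hypothesis cV : forall z w : 'rV[R]_J, V z - V w <= (\sum_i c z i * (z 0 i - w 0 i)) *+ 2.
Hypothesis K0 : 0 <= K.

Lemma coef0 i : c 0 i = 0. Proof. by rewrite -(subrr 0) cB subrr. Qed.
Lemma coefN z i : c (- z) i = - c z i. Proof. by rewrite -sub0r cB coef0 sub0r. Qed.

(* The endpoint [t] does not count: there [z r = z t] and the integrand is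
   nonpositive, so jumps of the solution need no separate treatment. *)
Lemma driven_step F C eta (z : R -> 'rV[R]_J) (s t D : R) :
  driven F C eta -> 0 <= D -> 0 <= s -> s <= t ->
  (forall r v, s < r <= t -> C r v -> \sum_i c (z r) i * v 0 i <= 0) ->
  (forall r i, s <= r <= t -> `|z t 0 i - z r 0 i| <= D) ->
  \sum_i c (z t) i * (eta t 0 i - eta s 0 i) <= K * D * fine (lsm F `]s, t[).
Proof.
move=> [g [mg gC geta]] D0 s0 st zC zD.
have -> : `]s, t[%classic = `]s, t[ `&` `]s, t] :> set R.
  by apply/esym/setIidl; apply: subset_itvl; rewrite bnd_simp.
apply: (driver_incr_le mg gC geta) => //; first by rewrite mulr_ge0.
move=> r v /andP[sr rt] Cv v1.
have -> : \sum_i c (z t) i * v 0 i =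
    \sum_i c (z r) i * v 0 i + \sum_i c (z t - z r) i * v 0 i.
  by rewrite -big_split/=; apply: eq_bigr => i _; rewrite cB; ring.
have le0 : \sum_i c (z r) i * v 0 i <= 0 by apply: zC => //; rewrite sr rt.
move: rt; rewrite le_eqVlt => /predU1P[rt|rt].
  rewrite [X in _ + X]big1 => [|i _]; last by rewrite rt subrr coef0 mul0r.
  by rewrite addr0; apply: le_trans le0 _; rewrite !mulr_ge0.
have -> : \1_(`]s, t[%classic : set R) r = 1 :> R.
  by rewrite indicE mem_set//= in_itv/= sr rt.
rewrite mulr1 -[leRHS]add0r lerD// cK// => i.
  by rewrite !mxE zD// !ltW.
by rewrite -v1 enorm_coord.
Qed.

Variables (F F' : cumulative R R) (C C' : R -> set 'rV[R]_J) (eta eta' : R -> 'rV[R]_J).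
Hypotheses (dF : driven F C eta) (dF' : driven F' C' eta').
Hypotheses (F0 : forall t, t < 0 -> F t = 0) (F'0 : forall t, t < 0 -> F' t = 0).
Variable z : R -> 'rV[R]_J.
Hypothesis zE : forall t, 0 <= t -> z t = eta t - eta' t.
Hypothesis z0 : z 0 = 0.
Hypothesis zC : forall r v, 0 <= r -> C r v -> \sum_i c (z r) i * v 0 i <= 0.
Hypothesis zC' : forall r v, 0 <= r -> C' r v -> 0 <= \sum_i c (z r) i * v 0 i.

Lemma driven_cumul_ge0 (H : cumulative R R) : (forall t, t < 0 -> H t = 0) ->
  forall t, 0 <= t -> 0 <= H t.
Proof.
move=> H0 t t0; rewrite -(H0 (-1)) ?ltrN10//.
by apply: (cumulative_is_nondecreasing H); lra.
Qed.

(** By [cV] the increment of [V] is at most twice the pairing with [c (z t)]. Replacing [c (z t)] by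
    [c (z r)] costs at most a multiple of the increment of [F + F'], and only on the open interval:
    the error is that increment times a mass excluding any jump at [t]. *)
Lemma energy_step s t : 0 <= s -> s <= t ->
  V (z t) - V (z s) <= K *+ 2 * (F t + F' t - (F s + F' s)) *
    (fine (lsm F `]s, t[) + fine (lsm F' `]s, t[)).
Proof.
move=> s0 st; have t0 : 0 <= t by lra.
have zD r i : s <= r <= t -> `|z t 0 i - z r 0 i| <= F t + F' t - (F s + F' s).
  move=> /andP[sr rt]; have r0 : 0 <= r by lra.
  have [[g [mg gC ge]] [g' [mg' gC' ge']]] := (dF, dF').
  have h := driver_incr_abs mg gC ge i r0 rt.
  have h' := driver_incr_abs mg' gC' ge' i r0 rt.
  have Fr : F s <= F r by exact: (cumulative_is_nondecreasing F).
  have F'r : F' s <= F' r by exact: (cumulative_is_nondecreasing F').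
  rewrite !zE// !mxE.
  rewrite (_ : _ - _ = (eta t 0 i - eta r 0 i) - (eta' t 0 i - eta' r 0 i)); last by ring.
  by apply: le_trans (ler_normB _ _) _; lra.
have D0 : 0 <= F t + F' t - (F s + F' s).
  rewrite subr_ge0 lerD//; [exact: (cumulative_is_nondecreasing F)|].
  exact: (cumulative_is_nondecreasing F').
apply: le_trans (cV _ _) _.
have h : \sum_i c (z t) i * (eta t 0 i - eta s 0 i) <=
    K * (F t + F' t - (F s + F' s)) * fine (lsm F `]s, t[).
  apply: (driven_step dF) => // r v /andP[sr _]; apply: zC; lra.
have h' : \sum_i c (- z t) i * (eta' t 0 i - eta' s 0 i) <=
    K * (F t + F' t - (F s + F' s)) * fine (lsm F' `]s, t[).
  apply: (driven_step (z := fun r => - z r) dF') => //.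
    move=> r v /andP[sr _] Cv; under eq_bigr do rewrite coefN mulNr.
    by rewrite sumrN oppr_le0; apply: zC' Cv; lra.
  by move=> r i /zD; rewrite !mxE -opprD normrN.
suff -> : \sum_i c (z t) i * (z t 0 i - z s 0 i) =
  \sum_i c (z t) i * (eta t 0 i - eta s 0 i) +
  \sum_i c (- z t) i * (eta' t 0 i - eta' s 0 i).
  by move: h h'; set a := \sum_i _; set b := \sum_i _; nra.
rewrite -big_split/=; apply: eq_bigr => i _.
by rewrite coefN !zE// !mxE; ring.
Qed.

(** For each [e], the bound [V (z t) <= e * G t] propagates across any interval whose open interior
    has mass at most [k]. Right continuity provides such intervals after every time and [lsm_left]
    before every time, jumps included. *)
Lemma energy_le0 t : 0 <= t -> V (z t) <= 0.
Proof.
pose G t := F t + F' t.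
have G0 r : 0 <= r -> 0 <= G r by move=> r0; rewrite addr_ge0// driven_cumul_ge0.
have Gnd r s : r <= s -> G r <= G s.
  move=> rs; apply: lerD; [exact: (cumulative_is_nondecreasing F)|].
  exact: (cumulative_is_nondecreasing F').
suff H e : 0 < e -> forall t, 0 <= t -> V (z t) <= e * G t.
  move=> t0; rewrite leNgt; apply/negP => V0; have Gt := G0 _ t0.
  (* With this [e], [e * G t] stays below [V (z t)]; the added 1 guards against [G t = 0]. *)
  have e0 : 0 < V (z t) / (G t + 1) / 2 by rewrite !divr_gt0//; lra.
  have := H _ e0 _ t0; apply/negP; rewrite -ltNge.
  move: V0 Gt; set v := V _; set G' := G t => V0 Gt.
  have G1 : 0 < G' + 1 by lra.
  have : v / (G' + 1) * G' < v.
    by rewrite mulrAC ltr_pdivrMr// ltr_pM2l//; lra.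
  have : 0 <= v / (G' + 1) * G' by rewrite mulr_ge0// divr_ge0 ?ltW.
  rewrite [v / (G' + 1) / 2 * G']mulrAC.
  by move: (v / (G' + 1) * G') => q; lra.
(* Chosen so that [K *+ 2 * k <= e], including when [K = 0]. *)
move=> e0; pose k := e / (K *+ 2 + 1).
have k0 : 0 < k by rewrite divr_gt0// ltr_wpDl// mulrn_wge0.
have kK : K *+ 2 * k <= e.
  have K1 : 0 < K *+ 2 + 1 by rewrite ltr_wpDl// mulrn_wge0.
  by rewrite /k mulrA ler_pdivrMr// mulrDr mulr1 mulrC lerDl ltW.
have step r s : 0 <= r -> r <= s ->
    fine (lsm F `]r, s[) + fine (lsm F' `]r, s[) <= k ->
    V (z r) <= e * G r -> V (z s) <= e * G s.
  move=> r0 rs m Vr; have D0 : 0 <= G s - G r by rewrite subr_ge0 Gnd.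
  have := energy_step r0 rs; rewrite -/(G s) -/(G r).
  move: m D0; set m := fine _ + fine _; set D := G s - G r => mk D0 h.
  have : V (z s) - V (z r) <= D * e.
    apply: le_trans h _; apply: le_trans (_ : K *+ 2 * D * k <= _).
      by apply: ler_wpM2l => //; rewrite mulr_ge0 // mulrn_wge0.
    by rewrite -mulrA mulrCA ler_wpM2l.
  by rewrite /D mulrBl ![_ * e]mulrC; move: Vr; set a := V _; set b := V _; lra.
apply: real_induction.
- rewrite z0 /V big1 ?mulr_ge0 ?G0// ?ltW// => i _; by rewrite mxE mulr0.
- move=> r r0 Vr; have k20 : 0 < k / 2 by lra.
  have [d Fd] := nondecreasing_right_continuousP r F k20.
  have [d' Fd'] := nondecreasing_right_continuousP r F' k20.
  exists (Num.min d%:num d'%:num); first by rewrite lt_min !gt0.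
  move=> s /andP[rs sd].
  have M (H : cumulative R R) : fine (lsm H `]r, s[) <= H s - H r.
    rewrite -lee_fin fineK; last first.
      rewrite ge0_fin_numE//; apply: (@lsm_fin _ _ _ r s) => //.
      by apply: subset_itvl; rewrite bnd_simp.
    rewrite -lsm_oc//; apply: le_measure; rewrite ?inE//.
    by apply: subset_itvl; rewrite bnd_simp.
  apply: (step r) => //.
  have := M F; have := M F'.
  have : F s <= F (r + d%:num).
    apply: (cumulative_is_nondecreasing F); apply: le_trans sd _.
    by rewrite lerD2l ge_min lexx.
  have : F' s <= F' (r + d'%:num).
    apply: (cumulative_is_nondecreasing F'); apply: le_trans sd _.
    by rewrite lerD2l ge_min lexx orbT.
  by move: Fd Fd'; lra.
- move=> s s0 IH; have k20 : 0 < k / 2 by lra.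
  have [d d0 Fd] := lsm_left F s k20.
  have [d' d'0 Fd'] := lsm_left F' s k20.
  pose r := Num.max 0 (Num.max (s - d) (s - d')).
  have rs : r < s by rewrite !gt_max s0/=; apply/andP; split; lra.
  have r0 : 0 <= r by rewrite le_max lexx.
  have M (H : cumulative R R) b : s - b <= r ->
      (lsm H `](s - b)%R, s[ <= (k / 2)%:E)%E -> fine (lsm H `]r, s[) <= k / 2.
    move=> br; rewrite -lee_fin fineK; last first.
      rewrite ge0_fin_numE//; apply: (@lsm_fin _ _ _ r s) => //.
      by apply: subset_itvl; rewrite bnd_simp.
    apply: le_trans; apply: le_measure; rewrite ?inE//.
    by apply: subset_itvr; rewrite bnd_simp.
  apply: (step r) => //; [exact: ltW| |by apply: IH; rewrite r0].
  have := M F d _ Fd; have := M F' d' _ Fd'.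
  by rewrite /r !le_max !lexx !orbT => /(_ isT) h /(_ isT) h'; lra.
Qed.
End Uniqueness.

Section SkorokhodUniqueness.
Variables (R : realType) (J : nat) (beta : 'rV[R]_J).
Hypothesis beta_01 : forall i, 0 < beta 0 i < 1.
Hypothesis beta_sum : \sum_i beta 0 i = 1.

Let b0 i : 0 < beta 0 i. Proof. by have /andP[] := beta_01 i. Qed.

Lemma skorokhod_driven psi phi eta : skorokhod_problem beta psi phi eta ->
  exists2 F : cumulative R R, driven F (fun r => dcone beta (phi r)) eta &
    forall t, t < 0 -> F t = 0.
Proof.
move=> sp; have [F [F0 _] [_ [g [mg gC ge]]]] := sp_constraint sp.
by exists F => //; exists g.
Qed.

(** The energy estimate is used twice. The squared sum of z has to come first, since [cone_form_le]
    compares only points of equal sum. *)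
Lemma skorokhod_unique psi phi eta phi' eta' :
  skorokhod_problem beta psi phi eta -> skorokhod_problem beta psi phi' eta' ->
  forall t, 0 <= t -> phi t = phi' t.
Proof.
move=> sp sp'; have [F dF F0] := skorokhod_driven sp.
have [F' dF' F'0] := skorokhod_driven sp'.
pose z t := phi t - phi' t.
have zE t : 0 <= t -> z t = eta t - eta' t.
  move=> t0; rewrite /z (sp_decomp sp)// (sp_decomp sp')//.
  by rewrite opprD addrACA subrr add0r.
have z0 : z 0 = 0 by rewrite /z (sp_init sp) (sp_init sp') subrr.
have ph0 t : 0 <= t -> orthant (phi t) by exact: sp_orthant sp _.
have ph'0 t : 0 <= t -> orthant (phi' t) by exact: sp_orthant sp' _.
have sumE t : 0 <= t -> \sum_j phi t 0 j = \sum_j phi' t 0 j.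
  move=> t0; apply/eqP; rewrite -subr_eq0 -sqrf_eq0 eq_le sqr_ge0 andbT.
  have zS r : \sum_i z r 0 i = \sum_j phi r 0 j - \sum_j phi' r 0 j.
    by rewrite -sumrB; apply: eq_bigr => i _; rewrite !mxE.
  suff : \sum_i (\sum_k z t 0 k) * z t 0 i <= 0 by rewrite -mulr_sumr zS.
  (* The constant [J * J]: in absolute value the sum of w is at most [J M], that of v at most
     [J]. *)
  apply: (@energy_le0 _ _ (fun w _ => \sum_k w 0 k) ((J * J)%:R) _ _ _ _
     _ _ _ _ _ _ dF dF' F0 F'0 z) => //.
  - by move=> w w' i; rewrite -sumrB; apply: eq_bigr => k _; rewrite !mxE.
  - move=> w M v wM v1.
    have S (f : 'I_J -> R) N : (forall i, `|f i| <= N) -> `|\sum_i f i| <= J%:R * N.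
      move=> fN; apply: le_trans (ler_norm_sum _ _ _) _.
      by rewrite mulr_natl -[in leRHS](card_ord J) -sumr_const ler_sum.
    rewrite -mulr_sumr; apply: le_trans (ler_norm _) _; rewrite normrM.
    rewrite natrM -mulrA [_ * M]mulrC mulrA -[X in _ <= _ * X]mulr1.
    by rewrite ler_pM// S.
  - move=> w w'; rewrite -!mulr_sumr sumrB.
    set a := \sum_i w 0 i; set a' := \sum_i w' 0 i.
    by have := sqr_ge0 (a - a'); rewrite mulr2n expr2; lra.
  - move=> r v r0 /(dconeP beta_01 beta_sum) Cv; rewrite -mulr_sumr zS.
    by apply: cone_sum_le Cv; exact: ph'0.
  - move=> r v r0 /(dconeP beta_01 beta_sum) Cv; rewrite -mulr_sumr zS.
    by rewrite -oppr_le0 -mulNr opprB; apply: cone_sum_le Cv; exact: ph0.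
move=> t t0; apply/rowP => j; apply/eqP; rewrite -subr_eq0; apply/eqP.
apply: (form_eq0 beta_01 (z := fun j => phi t 0 j - phi' t 0 j)).
have -> : \sum_j (phi t 0 j - phi' t 0 j) * (phi t 0 j - phi' t 0 j) / beta 0 j =
   \sum_j z t 0 j / beta 0 j * z t 0 j.
  by apply: eq_bigr => k _; rewrite /z !mxE mulrAC.
apply: (@energy_le0 _ _ (fun w i => w 0 i / beta 0 i) (\sum_i (beta 0 i)^-1) _ _ _ _
     _ _ _ _ _ _ dF dF' F0 F'0 z) => //.
- by move=> w w' i; rewrite !mxE mulrBl.
- move=> w M v wM v1; rewrite mulr_suml ler_sum// => i _.
  rewrite -mulrA mulrCA; have bi : 0 <= (beta 0 i)^-1 by rewrite invr_ge0 ltW.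
  rewrite ler_wpM2l//; apply: le_trans (ler_norm _) _; rewrite normrM.
  by rewrite -[M]mulr1 ler_pM.
- move=> w w'; rewrite -sumrB -sumrMnl ler_sum// => i _; rewrite ![_ / _ * _]mulrAC.
  have bi : 0 <= (beta 0 i)^-1 by rewrite invr_ge0 ltW.
  rewrite -mulrBl -mulrnAl ler_wpM2r//.
  by have := sqr_ge0 (w 0 i - w' 0 i); rewrite mulr2n expr2; lra.
- by rewrite sumr_ge0// => i _; rewrite invr_ge0 ltW.
- move=> r v r0 /(dconeP beta_01 beta_sum) Cv.
  have := cone_form_le (ph0 _ r0) (ph'0 _ r0) (sumE _ r0) Cv.
  by congr (_ <= _); apply: eq_bigr => i _; rewrite !mxE mulrAC.
- move=> r v r0 /(dconeP beta_01 beta_sum) Cv.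
  have := cone_form_le (ph'0 _ r0) (ph0 _ r0) (esym (sumE _ r0)) Cv.
  rewrite -oppr_ge0 -sumrN.
  by congr (_ <= _); apply: eq_bigr => i _; rewrite !mxE; ring.
Qed.
End SkorokhodUniqueness.

(** * Existence for affine inputs *)

Section LocallyAffine.
Variable R : realType.
Implicit Types f g : R -> R.

(* Affine on an initial segment of every ray, so one-sided on both sides of
   every point. *)
Definition locally_affine f := forall d t : R, exists2 e, 0 < e &
  exists v, forall s, 0 <= s <= e -> f (t + d * s) = f t + s * v.

Lemma locally_affine_cst a : locally_affine (fun=> a).
Proof. by move=> d t; exists 1 => //; exists 0 => s _; rewrite mulr0 addr0. Qed.

Lemma locally_affine_id : locally_affine id.
Proof. by move=> d t; exists 1 => //; exists d => s _; rewrite mulrC. Qed.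

Lemma locally_affineD f g : locally_affine f -> locally_affine g ->
  locally_affine (fun t => f t + g t).
Proof.
move=> pf pg d t; have [e e0 [v fv]] := pf d t; have [e' e'0 [w gw]] := pg d t.
exists (Num.min e e'); first by rewrite lt_min e0.
by exists (v + w) => s; rewrite le_min => /and3P[s0 se se']; rewrite fv ?gw ?s0//; ring.
Qed.

Lemma locally_affineZ a f : locally_affine f -> locally_affine (fun t => a * f t).
Proof.
move=> pf d t; have [e e0 [v fv]] := pf d t; exists e => //.
by exists (a * v) => s se; rewrite fv//; ring.
Qed.

Lemma locally_affineN f : locally_affine f -> locally_affine (fun t => - f t).
Proof.
move=> pf d t; have [e e0 [v fv]] := pf d t; exists e => //.
by exists (- v) => s se; rewrite fv//; ring.
Qed.

Lemma locally_affineB f g : locally_affine f -> locally_affine g ->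
  locally_affine (fun t => f t - g t).
Proof. by move=> pf /locally_affineN; exact: locally_affineD. Qed.

Lemma locally_affine_sum (I : Type) (r : seq I) (P : pred I) (F : I -> R -> R) :
  (forall i, locally_affine (F i)) -> locally_affine (fun t => \sum_(i <- r | P i) F i t).
Proof.
move=> pF; elim: r => [|i r IH].
  by under eq_fun do rewrite big_nil; exact: locally_affine_cst.
by under eq_fun do rewrite big_cons; case: (P i) => //; exact: locally_affineD.
Qed.

Lemma affine_stays_pos (a v : R) : 0 < a ->
  exists2 e, 0 < e & forall s, 0 <= s <= e -> 0 < a + s * v.
Proof.
move=> a0; have v1 : 0 < `|v| + 1 by rewrite ltr_wpDl.
exists (a / 2 / (`|v| + 1)) => [|s /andP[s0]]; first by rewrite !divr_gt0.
rewrite ler_pdivlMr// mulrDr mulr1 => sa.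
have : s * - `|v| <= s * v by rewrite ler_wpM2l// lerNl ler_normr lexx orbT.
by rewrite mulrN; lra.
Qed.

(** At a zero of [f] the maximum has a kink, yet along one ray [max 0 (s v) = s max 0 v]. This is
    why affinity is asked on rays and not on neighbourhoods. *)
Lemma locally_affine_max0 f : locally_affine f ->
  locally_affine (fun t => Num.max 0 (f t)).
Proof.
move=> pf d t; have [e e0 [v fv]] := pf d t.
have [ft|ft|ft] := ltgtP (f t) 0.
- have [e' e'0 H] : exists2 e, 0 < e & forall s, 0 <= s <= e -> 0 < - f t + s * - v.
    by apply: affine_stays_pos; rewrite oppr_gt0.
  exists (Num.min e e'); first by rewrite lt_min e0.
  exists 0 => s; rewrite le_min => /and3P[s0 se se']; rewrite mulr0 addr0 fv ?s0//.
  by rewrite max_l//; have := H s; rewrite s0 se' => /(_ isT); lra.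
- have [e' e'0 H] := affine_stays_pos v ft.
  exists (Num.min e e'); first by rewrite lt_min e0.
  exists v => s; rewrite le_min => /and3P[s0 se se']; rewrite fv ?s0//.
  by rewrite max_r//; have := H s; rewrite s0 se' => /(_ isT); lra.
- exists e => //; exists (Num.max 0 v) => s /andP[s0 se].
  by rewrite fv ?s0// ft !add0r maxr_pMr// mulr0.
Qed.

Lemma locally_affine_max f g : locally_affine f -> locally_affine g ->
  locally_affine (fun t => Num.max (f t) (g t)).
Proof.
move=> pf pg; have := locally_affineD pf (locally_affine_max0 (locally_affineB pg pf)).
by congr locally_affine; apply/funext => t; rewrite addr_maxr addr0 addrC subrK.
Qed.

Lemma locally_affine_bigmax (I : Type) (r : seq I) (P : pred I) (F : I -> R -> R) a :
  (forall i, locally_affine (F i)) ->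
  locally_affine (fun t => \big[Num.max/a]_(i <- r | P i) F i t).
Proof.
move=> pF; elim: r => [|i r IH].
  by under eq_fun do rewrite big_nil; exact: locally_affine_cst.
by under eq_fun do rewrite big_cons; case: (P i) => //; exact: locally_affine_max.
Qed.

Lemma locally_affine_stays_pos f t : locally_affine f -> 0 < f t ->
  exists2 e, 0 < e & forall s, 0 <= s <= e -> 0 < f (t + s).
Proof.
move=> pf ft; have [e e0 [v fv]] := pf 1 t; have [e' e'0 H] := affine_stays_pos v ft.
exists (Num.min e e'); first by rewrite lt_min e0.
move=> s; rewrite le_min => /and3P[s0 se se'].
by have := fv s; rewrite mul1r => ->; rewrite ?s0//; apply: H; rewrite s0.
Qed.

Lemma locally_affine_continuous f : locally_affine f -> continuous f.
Proof.
move=> pf t; apply/cvgrPdist_lt => e e0.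
have [a a0 [v fv]] := pf 1 t; have [b b0' [w fw]] := pf (-1) t.
pose k := e / (`|v| + `|w| + 1).
have n1 : 0 < `|v| + `|w| + 1 by rewrite ltr_wpDl// addr_ge0.
have k0 : 0 < k by rewrite divr_gt0.
have small s u : 0 <= s -> s < k -> `|u| <= `|v| + `|w| -> `|s * u| < e.
  move=> s0 sk uvw; rewrite normrM (ger0_norm s0).
  move: sk; rewrite /k ltr_pdivlMr//; apply: le_lt_trans.
  by rewrite ler_wpM2l// ler_wpDr.
have r0 : 0 < Num.min k (Num.min a b) by rewrite !lt_min k0 a0.
apply: filterS (nbhsx_ballx t _ r0) => s; rewrite /ball/= !lt_min => /and3P[sk sa sb].
have [ts|st] := leP t s.
  have st0 : 0 <= s - t by rewrite subr_ge0.
  move: sk sa; rewrite distrC ger0_norm// => sk sa.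
  have -> : f s = f t + (s - t) * v.
    by rewrite -fv ?st0 ?(ltW sa)// mul1r addrC subrK.
  by rewrite opprD addNKr normrN; apply: small; rewrite // lerDl.
have st0 : 0 <= t - s by rewrite subr_ge0 ltW.
move: sk sb; rewrite ger0_norm// => sk sb.
have -> : f s = f t + (t - s) * w.
  by rewrite -fw ?st0 ?(ltW sb)// mulN1r opprB addrC subrK.
by rewrite opprD addNKr normrN; apply: small; rewrite // lerDr.
Qed.

End LocallyAffine.

Section Enorm.
Variables (R : realType) (J : nat).
Implicit Types x y : 'rV[R]_J.

Lemma enorm_ge0 x : 0 <= enorm x. Proof. exact: sqrtr_ge0. Qed.

Lemma enorm_sqr x : enorm x ^+ 2 = \sum_i x 0 i ^+ 2.
Proof. by rewrite sqr_sqrtr// sumr_ge0// => i _; exact: sqr_ge0. Qed.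

Lemma enorm0 : enorm (0 : 'rV[R]_J) = 0.
Proof.
by apply/eqP; rewrite -sqrf_eq0 enorm_sqr big1// => i _; rewrite mxE expr0n.
Qed.

Lemma enorm_eq0 x : enorm x = 0 -> x = 0.
Proof.
move=> x0; apply/rowP => i; rewrite mxE; apply/eqP; rewrite -normr_le0 -x0.
exact: enorm_coord.
Qed.

Lemma enormZ a x : 0 <= a -> enorm (a *: x) = a * enorm x.
Proof.
move=> a0; rewrite /enorm; under eq_bigr do rewrite mxE exprMn.
by rewrite -mulr_sumr sqrtrM ?sqr_ge0// sqrtr_sqr ger0_norm.
Qed.

Lemma enorm_dot_le x y : \sum_i x 0 i * y 0 i <= enorm x * enorm y.
Proof.
have [x0|x0] := eqVneq (enorm x) 0.
  rewrite x0 mul0r big1 // => i _; by rewrite (enorm_eq0 x0) mxE mul0r.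
have [y0|y0] := eqVneq (enorm y) 0.
  rewrite y0 mulr0 big1 // => i _; by rewrite (enorm_eq0 y0) mxE mulr0.
have xy0 : 0 < enorm x * enorm y by rewrite mulr_gt0// lt_neqAle eq_sym ?x0 ?y0 enorm_ge0.
have : 0 <= \sum_i (x 0 i * enorm y - y 0 i * enorm x) ^+ 2.
  by apply: sumr_ge0 => i _; exact: sqr_ge0.
under eq_bigr do rewrite sqrrB !exprMn.
rewrite !big_split/= sumrN -!mulr_suml -!enorm_sqr.
have -> : \sum_i (x 0 i * enorm y * (y 0 i * enorm x)) *+ 2 =
   (enorm x * enorm y) * (\sum_i x 0 i * y 0 i) *+ 2.
  by rewrite mulr_sumr -sumrMnl; apply: eq_bigr => i _; congr (_ *+ 2); ring.
move: xy0; set p := enorm x; set q := enorm y; set d := \sum_i _ => pq h.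
have : p * q * d <= p * q * (p * q) by move: h; rewrite !mulr2n !expr2; lra.
by rewrite ler_pM2l.
Qed.

Lemma ler_enormD x y : enorm (x + y) <= enorm x + enorm y.
Proof.
rewrite -(@ler_pXn2r _ 2)// ?nnegrE ?addr_ge0 ?enorm_ge0// sqrrD !enorm_sqr.
under eq_bigr do rewrite mxE sqrrD.
rewrite !big_split/= lerD2r lerD2l mulr2n.
by apply: lerD; exact: enorm_dot_le.
Qed.

End Enorm.

(** * Total variation of paths made of affine segments *)

Section Pieces.
Variables (R : realType) (J : nat) (eta : R -> 'rV[R]_J).

Definition affine_on (a b : R) (w : 'rV[R]_J) :=
  a < b /\ forall s, a <= s <= b -> eta s = eta a + (s - a) *: w.

Lemma affine_onS a b c d w : affine_on a b w ->
  a <= c -> c < d -> d <= b -> affine_on c d w.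
Proof.
move=> [ab H] ac cd db; split=> // s /andP[cs sd].
rewrite (H s) ?(H c); last 2 first.
  by apply/andP; split; lra.
  by apply/andP; split; lra.
by rewrite -addrA -scalerDl; congr (_ + _ *: _); ring.
Qed.

(** Recursive form of [variation_along], suited to induction on the partition. *)
Fixpoint vsum a (s : seq R) : R :=
  if s is x :: s' then enorm (eta x - eta a) + vsum x s' else 0.

Lemma variation_alongE a b s : variation_along eta a b s = vsum a s.
Proof.
elim: s a => [|x s IH] a; rewrite /variation_along /=; first by rewrite big_geq.
rewrite big_nat_recl//= -IH; congr (_ + _).
Qed.

Lemma vsum_cat a s s' : vsum a (s ++ s') = vsum a s + vsum (last a s) s'.
Proof. by elim: s a => [|x s IH] a /=; rewrite ?add0r// IH addrA. Qed.

(** By the triangle inequality, inserting [c] into a partition can only increase the sum. *)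
Lemma vsum_split a c b s : itv_partition a b s -> a <= c -> c <= b ->
  exists s1 s2, [/\ itv_partition a c s1, itv_partition c b s2 &
    vsum a s <= vsum a s1 + vsum c s2].
Proof.
elim: s a => [|x s IH] a ps ac cb.
  exists [::], [::]; have ab := itv_partition_nil ps.
  have -> : c = a by apply/eqP; rewrite eq_le ac andbT ab.
  by split => //; rewrite /= addr0.
have [xc|cx] := leP x c.
  have [s1 [s2 [p1 p2 le]]] := IH x (itv_partition_cons ps) xc cb.
  exists (x :: s1), s2; split=> //; last by rewrite /= -addrA lerD2l.
  by move: ps p1 => [/= /andP[ax _] _] [q1 q2]; split; rewrite //= ax.
move: (ac); rewrite le_eqVlt => /predU1P[ac'|ac'].
  by exists [::], (x :: s); split; rewrite -?ac' ?add0r//; split => //=.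
exists [:: c], (x :: s); split.
- exact: itv_partition1.
- by move: ps => [/= /andP[ax xs] l]; split; rewrite //= cx.
- rewrite /= addr0 addrA lerD2r; apply: le_trans (ler_enormD _ _).
  rewrite [leRHS](_ : _ = enorm (eta x - eta a))//.
  by congr enorm; rewrite addrC addrA subrK.
Qed.

Lemma vsum_affine a b w c d s : affine_on a b w -> a <= c -> d <= b ->
  itv_partition c d s -> vsum c s = (d - c) * enorm w.
Proof.
move=> [ab H]; elim: s c => [|x s IH] c ac db ps.
  by rewrite (itv_partition_nil ps) subrr mul0r.
have cx : c < x by move: ps => [/= /andP[]].
have xd := itv_partition_le (itv_partition_cons ps).
have ax : a <= x by lra.
rewrite /= (IH x ax db (itv_partition_cons ps)).
have -> : eta x = eta a + (x - a) *: w by apply: H; rewrite ax (le_trans xd).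
have -> : eta c = eta a + (c - a) *: w by apply: H; rewrite ac; lra.
by rewrite opprD addrACA subrr add0r -scalerBl enormZ; [ring|lra].
Qed.

Local Notation tv := (tvar eta).

Lemma tvar_ub t s : itv_partition 0 t s -> ((vsum 0 s)%:E <= tv t)%E.
Proof.
by move=> ps; apply: ereal_sup_ubound; exists s => //; rewrite variation_alongE.
Qed.

Lemma tvar_le t M :
  (forall s, itv_partition 0 t s -> ((vsum 0 s)%:E <= M)%E) -> (tv t <= M)%E.
Proof.
move=> H; apply: ge_ereal_sup => _ [s ps <-].
by rewrite variation_alongE; exact: H.
Qed.

Lemma tvar0 : tv 0 = 0%E.
Proof.
apply/eqP; rewrite eq_le; apply/andP; split.
  by apply: tvar_le => s /itv_partitionxx ->.
by apply: (@tvar_ub 0 [::]); split => //=.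
Qed.

Lemma tvar_incr s t : s <= t -> (tv s + (enorm (eta t - eta s))%:E <= tv t)%E.
Proof.
rewrite le_eqVlt => /predU1P[->|st]; first by rewrite subrr enorm0 adde0.
rewrite -leeBrDr//; apply: tvar_le => p pp; rewrite leeBrDr// -EFinD.
have pt : itv_partition 0 t (p ++ [:: t]).
  by apply: itv_partition_cat pp _; exact: itv_partition1.
apply: le_trans (tvar_ub pt).
by rewrite vsum_cat/= addr0; case: pp => _ /eqP ->.
Qed.

(** Splitting every partition at [a] gives the upper bound. Appending the single point [b] gives the
    lower one, sharp because the direction is constant on the piece. *)
Lemma tvar_affine a b w : 0 <= a -> affine_on a b w ->
  tv b = (tv a + ((b - a) * enorm w)%:E)%E.
Proof.
move=> a0 [ab H]; have ab' := ltW ab.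
apply/eqP; rewrite eq_le; apply/andP; split.
  apply: tvar_le => s /(@vsum_split 0 a b) /(_ a0 ab')[s1 [s2 [p1 p2 le]]].
  rewrite -(vsum_affine (conj ab H) (lexx a) (lexx b) p2).
  apply: le_trans (_ : _ <= (vsum 0 s1 + vsum a s2)%:E)%E _; first by rewrite lee_fin.
  by rewrite EFinD leeD2r// tvar_ub.
have := tvar_incr ab'; rewrite H ?ab' ?lexx// addrAC subrr add0r enormZ//.
by rewrite subr_ge0.
Qed.

Hypothesis eta_pl : forall i, locally_affine (fun t => eta t 0 i).

Lemma affine_ray d t : exists2 e, 0 < e & exists w, forall s, 0 <= s <= e ->
  eta (t + d * s) = eta t + s *: w.
Proof.
have /choice[ew H] i : exists ew : R * R, 0 < ew.1 /\ forall s, 0 <= s <= ew.1 ->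
    eta (t + d * s) 0 i = eta t 0 i + s * ew.2.
  by have [e e0 [v fv]] := eta_pl i d t; exists (e, v).
exists (\big[Num.min/1]_i (ew i).1).
  by apply: lt_bigmin => // i _; have [] := H i.
exists (\row_i (ew i).2) => s /andP[s0 se]; apply/rowP => i; rewrite !mxE.
apply: (H i).2; rewrite s0; apply: le_trans se _.
exact: bigmin_le.
Qed.

Lemma right_piece t : exists2 e, 0 < e & exists w, affine_on t (t + e) w.
Proof.
have [e e0 [w H]] := affine_ray 1 t; exists e => //; exists w.
split=> [|s /andP[ts se]]; first by rewrite ltrDl.
rewrite -H ?mul1r ?[t + _]addrC ?subrK//; apply/andP; split; lra.
Qed.

Lemma left_piece t : 0 < t -> exists a, 0 <= a < t /\ exists w, affine_on a t w.
Proof.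
move=> t0; have [e e0 [w H]] := affine_ray (-1) t.
have H' s : t - e <= s <= t -> eta s = eta t + (t - s) *: w.
  move=> /andP[es st]; rewrite -H; first by rewrite mulN1r opprB addrC subrK.
  by apply/andP; split; lra.
exists (Num.max 0 (t - e)); set a := Num.max _ _.
have a0 : 0 <= a by rewrite le_max lexx.
have ae : t - e <= a by rewrite le_max lexx orbT.
have at' : a < t by rewrite gt_max t0; lra.
split; first by rewrite a0.
exists (- w); split=> // s /andP[as' st]; rewrite (H' s) ?(H' a); last 2 first.
  by apply/andP; split; lra.
  by apply/andP; split; lra.
rewrite scalerN -addrA -scalerBl; congr (_ + _ *: _); ring.
Qed.

(** Affine pieces on both sides of each point meet the local conditions of [real_induction], so no
    finite subdivision has to be produced. *)
Lemma piece_induction (P : R -> Prop) : P 0 ->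
  (forall a b w, 0 <= a -> affine_on a b w -> P a -> P b) ->
  forall t, 0 <= t -> P t.
Proof.
move=> P0 step; apply: real_induction => // [t t0 Pt|t t0 IH].
  have [e e0 [w H]] := right_piece t; exists e => // s /andP[].
  rewrite le_eqVlt => /predU1P[<-//|ts se]; apply: step t0 _ Pt.
  exact: affine_onS H (lexx t) ts se.
have [a [/andP[a0 at'] [w H]]] := left_piece t0.
by apply: (step _ _ _ a0 H); apply: IH; rewrite a0.
Qed.

Lemma tvar_fin t : 0 <= t -> tv t \is a fin_num.
Proof.
move: t; apply: piece_induction; first by rewrite tvar0.
by move=> a b w a0 H fa; rewrite (tvar_affine a0 H) fin_numD fa.
Qed.

Definition slope t : 'rV[R]_J :=
  xget 0 [set w | exists2 e, 0 < e & affine_on t (t + e) w].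

Lemma slope_right t : exists2 e, 0 < e & affine_on t (t + e) (slope t).
Proof.
rewrite /slope; case: xgetP => [w -> //|no].
by have [e e0 [w H]] := right_piece t; exfalso; apply: (no w); exists e.
Qed.

Lemma slope_affine a b w s : affine_on a b w -> a <= s -> s < b -> slope s = w.
Proof.
move=> H as' sb; have [e e0 [_ He]] := slope_right s.
have {}H := affine_onS H as' sb (lexx b); case: H => _ H.
pose r := s + Num.min e (b - s).
have m0 : 0 < Num.min e (b - s) by rewrite lt_min e0 subr_gt0.
have re : r <= s + e by rewrite lerD2l ge_min lexx.
have rb : r <= b by rewrite -lerBrDl ge_min lexx orbT.
have sr : s <= r by rewrite lerDl ltW.
have rs : r - s != 0 by rewrite /r addrAC subrr add0r gt_eqF.
by have := He r; rewrite (H r) ?sr// => /(_ re)/addrI/(scalerI rs).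
Qed.

End Pieces.

(** * The variation measure of such a path and its unit direction *)

Section PiecewiseMeasure.
Variables (R : realType) (J : nat) (eta : R -> 'rV[R]_J).
Hypothesis eta_pl : forall i, locally_affine (fun t => eta t 0 i).
Notation lsm := lebesgue_stieltjes_measure.

Lemma slope_ray t : exists2 e, 0 < e & forall s, 0 <= s <= e ->
  eta (t + s) = eta t + s *: slope eta t.
Proof.
have [e e0 [_ H]] := slope_right eta_pl t; exists e => // s /andP[s0 se].
rewrite (H (t + s)); last by apply/andP; split; lra.
by rewrite addrAC subrr add0r.
Qed.

(** A pointwise limit of the difference quotients [h n], which at each [t] are eventually
    constant. *)
Lemma measurable_slope i : measurable_fun setT (fun t => slope eta t 0 i).
Proof.
pose h n t := n.+1%:R * (eta (t + n.+1%:R^-1) 0 i - eta t 0 i).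
have mh n : measurable_fun setT (h n : R -> R).
  apply: measurable_funM => //; apply: measurable_funB.
    apply: continuous_measurable_fun; apply: locally_affine_continuous => d t.
    have [e e0 [v H]] := eta_pl i d (t + n.+1%:R^-1); exists e => //; exists v => s se.
    by rewrite -H// addrAC.
  by apply: continuous_measurable_fun; apply: locally_affine_continuous.
apply: (measurable_fun_cvg mh) => t _.
apply: cvg_near_cst; have [e e0 H] := slope_ray t.
near=> n; rewrite /h H ?mxE; first by rewrite addrAC subrr add0r mulrA divff ?mul1r.
rewrite invr_ge0 ler0n/= ltW//.
by near: n; exact: near_infty_natSinv_lt (PosNum e0).
Unshelve. all: by end_near. Qed.

(* Zero, hence not a unit vector, on the null set where the slope vanishes. *)
Definition driver t : 'rV[R]_J := (enorm (slope eta t))^-1 *: slope eta t.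

Lemma measurable_driver i : measurable_fun setT (fun t => driver t 0 i).
Proof.
(* Writing the inverse norm as a power reduces the claim to measurability of [powR]; at a zero slope
   both sides are 0. *)
rewrite (_ : (fun _ => _) = fun t =>
  (\sum_j slope eta t 0 j ^+ 2) `^ (- 2^-1) * slope eta t 0 i); last first.
  apply/funext => t; rewrite mxE powRN powR12_sqrt//.
  by apply: sumr_ge0 => j _; exact: sqr_ge0.
apply: measurable_funM; last exact: measurable_slope.
apply: (@measurableT_comp _ _ _ _ _ _ (fun x : R => x `^ (- 2^-1))).
  exact: measurable_powR.
by apply: measurable_sum => j; apply: measurable_funX; exact: measurable_slope.
Qed.

Lemma exists_tvar_fun : exists F : cumulative R R, is_tvar_fun eta F.
Proof.
pose F0 t := if t < 0 then 0 else fine (tvar eta t).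
have FE t : 0 <= t -> (F0 t)%:E = tvar eta t.
  by move=> t0; rewrite /F0 ltNge t0/= fineK// tvar_fin.
have F00 t : t < 0 -> F0 t = 0 by rewrite /F0 => ->.
have F0_ge0 t : 0 <= F0 t.
  rewrite /F0; case: ifPn => // t0; apply: fine_ge0.
  have := @tvar_incr _ _ eta 0 t; rewrite leNgt => /(_ t0).
  by rewrite tvar0 add0e; apply: le_trans; rewrite lee_fin enorm_ge0.
have Fnd : {homo F0 : s t / s <= t}.
  move=> s t st; have [s0|s0] := ltP s 0; first by rewrite (F00 s).
  rewrite -lee_fin !FE//; last exact: le_trans st.
  by apply: le_trans (tvar_incr eta st); rewrite leeDl// lee_fin enorm_ge0.
have Frc : right_continuous F0.
  move=> t; have [t0|t0] := ltP t 0.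
    by apply: cvg_near_cst; apply: filterS (nbhs_right_lt t0) => s s0; rewrite !F00.
  have [e e0 H] := slope_right eta_pl t; set w := slope eta t in H.
  apply/cvgrPdist_le => k k0.
  have n1 : 0 < enorm w + 1 by rewrite ltr_wpDl// enorm_ge0.
  near=> s.
  have ts : t < s by near: s; exact: nbhs_right_gt.
  have se : s < t + e by near: s; apply: nbhs_right_lt; rewrite ltrDl.
  have sk : s < t + k / (enorm w + 1).
    by near: s; apply: nbhs_right_lt; rewrite ltrDl divr_gt0.
  have E : F0 s = F0 t + (s - t) * enorm w.
    apply: EFin_inj; rewrite EFinD !FE//; last by lra.
    by apply: tvar_affine => //; exact: affine_onS H (lexx _) ts (ltW se).
  rewrite E opprD addNKr normrN ger0_norm; last first.
    by rewrite mulr_ge0 ?enorm_ge0//; lra.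
  have : (s - t) * (enorm w + 1) <= k by rewrite -ler_pdivlMr//; lra.
  by rewrite mulrDr; lra.
pose F : cumulative R R := HB.pack F0 (isCumulative.Build R _ R F0 Fnd Frc).
by exists F; split=> t; [exact: F00|exact: FE].
Unshelve. all: by end_near. Qed.

Variable F : cumulative R R.
Hypothesis F_tvar : is_tvar_fun eta F.

Lemma tvar_fun0 : F 0 = 0.
Proof. by apply: EFin_inj; rewrite (F_tvar.2 _ (lexx 0)) tvar0. Qed.

Lemma tvar_fun_affine a b w : 0 <= a -> affine_on eta a b w ->
  F b = F a + (b - a) * enorm w.
Proof.
move=> a0 H; apply: EFin_inj; rewrite EFinD !(F_tvar.2)//; last first.
  by apply: le_trans a0 _; exact: ltW H.1.
exact: tvar_affine.
Qed.

Lemma lsm_affine a b w : 0 <= a -> affine_on eta a b w ->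
  lsm F `]a, b] = ((b - a) * enorm w)%:E.
Proof.
move=> a0 H; rewrite lsm_oc; last exact: ltW H.1.
by rewrite (tvar_fun_affine a0 H) addrAC subrr add0r.
Qed.

(** An affine piece ending at [t] gives []c, t]] a mass proportional to its length. At time 0 there
    is no such piece, but [F] vanishes at 0 and before. *)
Lemma lsm_point t : 0 <= t -> lsm F [set t] = 0%E.
Proof.
rewrite le_eqVlt => /predU1P[<-|t0]; apply/eqP; rewrite eq_le measure_ge0 andbT.
  have -> : 0%E = lsm F `](-1)%R, 0%R].
    by rewrite lsm_oc ?lerN10// tvar_fun0 (F_tvar.1 (-1)) ?ltrN10// subrr.
  apply: le_measure; rewrite ?inE//.
  by move=> _ ->; rewrite /= in_itv/= lexx ltrN10.
have [a [/andP[a0 a_t] [w H]]] := left_piece eta_pl t0.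
apply/lee_addgt0Pr => e e0; rewrite add0e.
have n1 : 0 < enorm w + 1 by rewrite ltr_wpDl// enorm_ge0.
pose c := Num.max a (t - e / (enorm w + 1)).
have ac : a <= c by rewrite le_max lexx.
have ec : t - e / (enorm w + 1) <= c by rewrite le_max lexx orbT.
have ct : c < t by rewrite gt_max a_t/= ltrBlDr ltrDl divr_gt0.
apply: (@le_trans _ _ (lsm F `]c, t])).
  apply: le_measure; rewrite ?inE//.
  by move=> _ ->; rewrite /= in_itv/= lexx ct.
have c0 : 0 <= c by lra.
rewrite (lsm_affine c0 (affine_onS H ac ct (lexx t))) lee_fin.
have : (t - c) * (enorm w + 1) <= e by rewrite -ler_pdivlMr//; lra.
by rewrite mulrDr; lra.
Qed.

(** At [b] the driver already follows the next piece, but [b] is a null point. If [w = 0], the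
    driver is 0 instead of a unit vector and both sides vanish. *)
Lemma integral_driver_affine a b w i : 0 <= a -> affine_on eta a b w ->
  (\int[lsm F]_(s in `]a, b]) (driver s 0 i)%:E = ((b - a) * w 0 i)%:E)%E.
Proof.
move=> a0 H; have ab := H.1.
rewrite (ae_eq_integral (cst (((enorm w)^-1 *: w) 0 i)%:E))//; last first.
- exists [set b]; split; first exact: measurable_set1.
    by apply: lsm_point; lra.
  move=> s /= /not_implyP[]; rewrite in_itv/= => /andP[as' sb] ns.
  apply: contrapT => /eqP sb'; apply: ns.
  by rewrite /driver (slope_affine eta_pl H (ltW as'))// lt_neqAle sb'.
- by apply/measurable_EFinP; apply: measurable_funS (measurable_driver i).
rewrite integral_cst//= (lsm_affine a0 H) -EFinM mxE.
have [w0|w0] := eqVneq (enorm w) 0; first by rewrite (enorm_eq0 w0) !mxE !mulr0 mul0r.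
by congr EFin; field.
Qed.

(** A piece with slope zero carries no mass, and on any other piece only the right endpoint can have
    slope zero. *)
Lemma slope_null : (lsm F).-negligible [set s | 0 <= s /\ slope eta s = 0].
Proof.
have H t : 0 <= t -> (lsm F).-negligible [set s | 0 <= s <= t /\ slope eta s = 0].
  move: t; apply: (piece_induction eta_pl).
    exists [set 0]; split; [exact: measurable_set1|exact: lsm_point|].
    by move=> s [s0 _] /=; lra.
  move=> a b w a0 H na; have ab := H.1.
  apply: (@negligibleS _ _ _ (lsm F) ([set s | 0 <= s <= a /\ slope eta s = 0] `|`
      [set s | a < s <= b /\ slope eta s = 0])).
    move=> s [/andP[s0 sb] s1].
    by have [sa|sa] := leP s a; [left|right]; split=> //; apply/andP.
  apply: negligibleU => //; have [w0|w0] := eqVneq (enorm w) 0.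
    exists `]a, b]%classic; split=> //.
      by have := lsm_affine a0 H; rewrite w0 mulr0.
    by move=> s [] /=; rewrite in_itv.
  exists [set b]; split; [exact: measurable_set1|by apply: lsm_point; lra|].
  move=> s [/andP[as' sb] s0] /=; apply: contrapT => /eqP sb'.
  have sb1 : s < b by rewrite lt_neqAle sb'.
  by move: w0; rewrite -(slope_affine eta_pl H (ltW as') sb1) s0 enorm0 eqxx.
apply: (@negligibleS _ _ _ (lsm F)
   (\bigcup_n [set s | 0 <= s <= n%:R /\ slope eta s = 0])).
  move=> s [s0 s1]; exists (Num.bound s) => //=; split=> //.
  by rewrite s0/= ltW// archi_boundP.
by apply: negligible_bigcup => n; exact: H.
Qed.

Hypothesis eta0 : eta 0 = 0.

Lemma integral_driver t i : 0 <= t ->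
  (eta t 0 i)%:E = (\int[lsm F]_(s in `[0%R, t]) (driver s 0 i)%:E)%E.
Proof.
move: t; apply: (piece_induction eta_pl).
  rewrite eta0 mxE set_itv1 (ae_eq_integral (cst 0%E))//; first by rewrite integral0.
    by apply/measurable_EFinP; apply: measurable_funS (measurable_driver i).
  exists [set 0]; split; [exact: measurable_set1|exact: lsm_point|].
  by move=> s /= /not_implyP[].
move=> a b w a0 H IH; have ab := H.1.
have E : `[0, b]%classic = `[0, a] `|` `]a, b] :> set R.
  by apply: itv_bndbnd_setU; rewrite bnd_simp// ltW.
have dE : [disjoint `[0, a] & `]a, b]]%classic.
  by apply/disj_setPS => x /= []; rewrite !in_itv/=; lra.
rewrite E integral_setU//; last first.
  by apply/measurable_EFinP; apply: measurable_funS (measurable_driver i).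
rewrite -IH (integral_driver_affine _ a0 H) -EFinD; congr EFin.
by have [_ ->] := H; rewrite ?(ltW ab) ?lexx// !mxE.
Qed.

End PiecewiseMeasure.

(** * The projected ray as a solution of the Skorokhod problem *)

Section Existence.
Variables (R : realType) (J : nat) (beta : 'rV[R]_J).
Hypothesis beta_01 : forall i, 0 < beta 0 i < 1.
Hypothesis beta_sum : \sum_i beta 0 i = 1.
Implicit Types (x y v : 'rV[R]_J) (i j : 'I_J).

Let b0 i : 0 < beta 0 i. Proof. by have /andP[] := beta_01 i. Qed.

Lemma coneZ a x v : 0 <= a -> cone beta x v -> cone beta x (a *: v).
Proof.
move=> a0; have S : \sum_j (a *: v) 0 j = a * \sum_j v 0 j.
  by rewrite mulr_sumr; apply: eq_bigr => j _; rewrite mxE.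
rewrite /cone S; case: ifP => [_ v0|_ [-> vm]]; first by rewrite mulr_ge0.
by rewrite mulr0; split=> // i j xi; rewrite !mxE -!mulrA ler_wpM2l// vm.
Qed.

Lemma lam_orthant x : orthant x -> lam beta x = 0.
Proof.
move=> x0; apply/eqP; rewrite eq_le lam_ge0 andbT.
have [A nA lA] := lam_attained beta_01 beta_sum x.
have mA := proper_mass beta_01 beta_sum nA.
by rewrite -(pmulr_lle0 _ mA) lA oppr_le0 sumr_ge0.
Qed.

(** The set attaining [lam] at the combination is tested at both ends. *)
Lemma lam_convex x y (a : R) : 0 <= a <= 1 ->
  lam beta ((1 - a) *: x + a *: y) <= (1 - a) * lam beta x + a * lam beta y.
Proof.
move=> /andP[a0 a1]; set z := _ + _.
have [A nA lA] := lam_attained beta_01 beta_sum z.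
have mA := proper_mass beta_01 beta_sum nA.
rewrite -(ler_pM2r mA) lA mulrDl -!mulrA.
have -> : - (\sum_(i in A) z 0 i) =
    (1 - a) * - (\sum_(i in A) x 0 i) + a * - (\sum_(i in A) y 0 i).
  rewrite !mulrN -opprD !mulr_sumr -big_split/=; congr (- _).
  by apply: eq_bigr => i _; rewrite !mxE.
have x1 := lam_ge beta_01 beta_sum x nA; have y1 := lam_ge beta_01 beta_sum y nA.
by rewrite lerD// ler_wpM2l// subr_ge0.
Qed.

Variables ubar nu : 'rV[R]_J.
Hypothesis ubar0 : orthant ubar.

Let psi (t : R) : 'rV[R]_J := ubar + t *: nu.
Let phi (t : R) := gps_proj beta (psi t).
Let eta (t : R) := phi t - psi t.

Lemma etaE t i : eta t 0 i = phi t 0 i - psi t 0 i.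
Proof. by rewrite !mxE. Qed.

Lemma psi_pl i : locally_affine (fun t => psi t 0 i).
Proof.
rewrite /psi; under eq_fun do rewrite !mxE [_ * nu 0 i]mulrC.
apply: locally_affineD; first exact: locally_affine_cst.
by apply: locally_affineZ; exact: locally_affine_id.
Qed.

Lemma psi_sum_pl : locally_affine (fun t => \sum_i psi t 0 i).
Proof. by apply: locally_affine_sum => i; exact: psi_pl. Qed.

Lemma shift_pl i : locally_affine (fun t => nonneg_shift beta (psi t) 0 i).
Proof.
under eq_fun do rewrite mxE [X in _ + X]mxE [_ * beta 0 i]mulrC.
apply: locally_affineD; first exact: psi_pl.
by apply/locally_affineZ/locally_affine_max0/locally_affineN; exact: psi_sum_pl.
Qed.

Lemma phi_pl i : locally_affine (fun t => phi t 0 i).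
Proof.
rewrite /phi; under eq_fun do rewrite mxE.
apply/locally_affine_max0/locally_affineB; first exact: shift_pl.
apply: locally_affineZ; apply: locally_affine_bigmax => A.
under eq_fun do rewrite mulrC.
by apply/locally_affineZ/locally_affineN; apply: locally_affine_sum => k; exact: shift_pl.
Qed.

Lemma eta_pl i : locally_affine (fun t => eta t 0 i).
Proof.
under eq_fun do rewrite etaE.
by apply: locally_affineB; [exact: phi_pl|exact: psi_pl].
Qed.

Lemma eta_sum t : \sum_j eta t 0 j = Num.max 0 (- \sum_j psi t 0 j).
Proof.
under eq_bigr do rewrite etaE.
by rewrite sumrB gps_proj_sum// addrC addr_maxr addr0 addrC subrr maxC.
Qed.

Lemma psi_sumE t : \sum_j psi t 0 j = \sum_j ubar 0 j + t * \sum_j nu 0 j.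
Proof.
by rewrite mulr_sumr -big_split/=; apply: eq_bigr => j _; rewrite !mxE.
Qed.

(* Once below its floor, the excess of a class keeps decreasing, by concavity:
   it was nonnegative at time zero. *)
Lemma excess_antitone j t s : 0 <= t -> 0 < s ->
  psi t 0 j - beta 0 j * lam beta (psi t) < 0 ->
  psi (t + s) 0 j - beta 0 j * lam beta (psi (t + s)) <=
    psi t 0 j - beta 0 j * lam beta (psi t).
Proof.
move=> t0 s0; set f := fun r => psi r 0 j - beta 0 j * lam beta (psi r).
rewrite -/(f t) -/(f (t + s)) => ft.
have f0 : 0 <= f 0.
  rewrite /f /psi scale0r addr0 lam_orthant// mulr0 subr0; exact: ubar0.
have {}t0 : 0 < t.
  by rewrite lt_neqAle t0 andbT; apply: contraTneq ft => <-; rewrite -leNgt.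
have ts0 : 0 < t + s by lra.
pose a := t / (t + s).
have a0 : 0 < a by rewrite divr_gt0.
have a1 : a <= 1 by rewrite ler_pdivrMr// mul1r; lra.
have E : psi t = (1 - a) *: psi 0 + a *: psi (t + s).
  rewrite /psi; apply/rowP => k; rewrite !mxE mul0r addr0 /a.
  by field; rewrite gt_eqF.
have lc : lam beta (psi t) <= (1 - a) * lam beta (psi 0) + a * lam beta (psi (t + s)).
  by rewrite {1}E; apply: lam_convex; rewrite ltW.
have conc : (1 - a) * f 0 + a * f (t + s) <= f t.
  have Ej : psi t 0 j = (1 - a) * psi 0 0 j + a * psi (t + s) 0 j.
    by rewrite {1}E mxE; congr (_ + _); rewrite mxE.
  have := ler_wpM2l (ltW (b0 j)) lc; rewrite /f Ej.
  move: (lam _ _) (lam _ _) (lam _ _) (psi 0 0 j) (psi (t + s) 0 j) => *; lra.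
have fts : a * f (t + s) <= f t.
  by apply: le_trans conc; rewrite lerDr mulr_ge0// subr_ge0.
have fn : f (t + s) < 0 by rewrite -(pmulr_rlt0 _ a0); apply: le_lt_trans ft.
apply: le_trans fts; rewrite -[leLHS]mul1r ler_wnM2r//; exact: ltW.
Qed.

(** [gps_proj_cone] puts [eta t] itself in the cone, whereas the Skorokhod problem asks this of its
    growth. A positive class grows with ratio minus the growth of [lam]; every other class has to be
    compared with it. *)
Lemma slope_cone t : 0 <= t -> cone beta (phi t) (slope eta t).
Proof.
move=> t0; have [e e0 H] := slope_ray eta_pl t; set v := slope eta t in H *.
have vE s j : 0 <= s <= e -> s * v 0 j = eta (t + s) 0 j - eta t 0 j.
  by move=> se; rewrite H// !mxE addrAC subrr add0r.
have vS s : 0 <= s <= e -> s * \sum_j v 0 j = \sum_j eta (t + s) 0 j - \sum_j eta t 0 j.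
  by move=> se; rewrite mulr_sumr -sumrB; apply: eq_bigr => j _; exact: vE.
rewrite /cone; case: ifPn => [/eqP p0|p0].
  have St : \sum_j psi t 0 j <= 0.
    have S0 : \sum_j phi t 0 j = 0 by rewrite p0 big1// => j _; rewrite mxE.
    rewrite leNgt; apply/negP => h; have := gps_proj_sum beta_01 beta_sum (psi t).
    by rewrite -/(phi t) S0 (max_r (ltW h)); lra.
  have ee : 0 <= e <= e by rewrite (ltW e0) lexx.
  rewrite -(pmulr_rge0 _ e0) (vS _ ee) !eta_sum subr_ge0.
  rewrite (max_r (_ : 0 <= - \sum_j psi t 0 j)) ?oppr_ge0// le_max lerN2.
  move: St; rewrite !psi_sumE; have : 0 <= \sum_j ubar 0 j by rewrite sumr_ge0.
  set a := \sum_j ubar 0 j; set b := \sum_j nu 0 j => a0 St.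
  (* The total of [eta] is the negative part of the total of [psi]. It grows under a nonpositive
     total drift; under a positive one the total of [psi], nonnegative at time 0, is still so at
     [t], and the negative part there is 0. *)
  have [b_le|b_gt] := leP b 0.
    by apply/orP; right; rewrite lerD2l ler_wnM2r// lerDl ltW.
  have tb : 0 <= t * b by rewrite mulr_ge0// ltW.
  by apply/orP; left; lra.
have St : 0 < \sum_j psi t 0 j.
  rewrite ltNge; apply: contra p0 => St; apply/eqP/row_sum_eq0.
    exact: gps_proj_orthant.
  by rewrite gps_proj_sum//; apply/max_idPl.
have [e1 e10 H1] := locally_affine_stays_pos psi_sum_pl St.
have phiE s : 0 < \sum_j psi s 0 j ->
    forall j, phi s 0 j = Num.max 0 (psi s 0 j - beta 0 j * lam beta (psi s)).
  by move=> Ss j; rewrite /phi /gps_proj (nonneg_shift_id _ (ltW Ss)) mxE.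
split.
  pose s := Num.min e e1; have s0 : 0 < s by rewrite lt_min e0.
  have se : 0 <= s <= e by rewrite ltW//= ge_min lexx.
  have : s * \sum_j v 0 j = 0.
    rewrite vS// !eta_sum !max_l ?subrr// oppr_le0 ltW// H1// ltW//=.
    by rewrite ge_min lexx orbT.
  by move/eqP; rewrite mulf_eq0 gt_eqF//= => /eqP.
move=> i j pi.
have pi0 : 0 < phi t 0 i by rewrite lt_neqAle eq_sym pi gps_proj_orthant.
have [e2 e20 H2] := locally_affine_stays_pos (phi_pl i) pi0.
pose s := Num.min e (Num.min e1 e2).
have s0 : 0 < s by rewrite !lt_min e0 e10.
have se : 0 <= s <= e by rewrite ltW//= ge_min lexx.
have Sts : 0 < \sum_j psi (t + s) 0 j.
  by apply: H1; rewrite ltW//= !ge_min lexx !orbT.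
have pits : 0 < phi (t + s) 0 i.
  by apply: H2; rewrite ltW//= !ge_min lexx !orbT.
have pos_eta r : 0 < \sum_j psi r 0 j -> 0 < phi r 0 i ->
    eta r 0 i = - (beta 0 i * lam beta (psi r)).
  move=> Sr; rewrite etaE phiE// lt_max ltxx/= => f0.
  by rewrite max_r ?ltW// addrAC subrr add0r.
rewrite -(ler_pM2l s0) !mulrA !vE// !pos_eta//.
pose dl := lam beta (psi (t + s)) - lam beta (psi t).
have -> : (- (beta 0 i * lam beta (psi (t + s))) -
    - (beta 0 i * lam beta (psi t))) / beta 0 i = - dl.
  by rewrite /dl; field; rewrite gt_eqF.
rewrite ler_pdivlMr// !etaE.
(* A class with nonnegative excess at [t] moves like a positive one, up to truncation. For a class
   below its floor [eta_j] equals [- psi_j] at [t], and the decrease of its excess is the inequality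
   sought. *)
rewrite !phiE//; have [fj|fj] := leP 0 (psi t 0 j - beta 0 j * lam beta (psi t)).
  apply: le_trans (_ : psi (t + s) 0 j - beta 0 j * lam beta (psi (t + s)) -
      psi (t + s) 0 j - (psi t 0 j - beta 0 j * lam beta (psi t) - psi t 0 j) <= _).
    by rewrite /dl; lra.
  by rewrite lerD2r lerD2r le_max lexx orbT.
have anti := excess_antitone t0 s0 fj.
apply: le_trans (_ : 0 - psi (t + s) 0 j - (0 - psi t 0 j) <= _).
  by rewrite /dl; lra.
by rewrite lerD2r lerD2r le_max lexx.
Qed.

Notation lsm := lebesgue_stieltjes_measure.

Lemma psi_continuous : continuous psi.
Proof. by move=> t; apply: cvgD; [exact: cvg_cst|apply: cvgZr_tmp; exact: cvg_id]. Qed.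

Lemma phi_bd_measurable : measurable (phi @^-1` bd_orthant (R:=R) (J:=J)).
Proof.
have -> : phi @^-1` bd_orthant (R:=R) (J:=J) =
    \bigcup_(i in [set: 'I_J]) ((fun t => phi t 0 i) @^-1` [set 0]).
  apply/seteqP; split=> t; first by move=> /bd_orthantP[_ [i pi]]; exists i.
  move=> [i _ pi]; apply/bd_orthantP; split; first exact: gps_proj_orthant.
  by exists i.
apply: fin_bigcup_measurable => // i _.
rewrite -[X in measurable X]setTI.
have := continuous_measurable_fun (locally_affine_continuous (phi_pl i)).
by apply.
Qed.

Lemma fluid_solution : skorokhod_problem beta psi phi eta.
Proof.
have eta0 : eta 0 = 0.
  by rewrite /eta /phi /psi scale0r addr0 gps_proj_id// subrr.
have [F FT] := exists_tvar_fun eta_pl.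
have cont := psi_continuous.
have zero_cone s : 0 <= s -> ~ bd_orthant (phi s) -> slope eta s = 0.
  move=> s0 nb; apply: cone_interior (slope_cone s0) => // i.
  rewrite lt_neqAle gps_proj_orthant andbT eq_sym; apply/eqP => pi.
  by apply: nb; apply/bd_orthantP; split; [exact: gps_proj_orthant|exists i].
split.
- split=> t t0; first by apply: cvg_at_right_filter; exact: cont.
  by apply/cvg_ex; exists (psi t); apply: cvg_at_left_filter; exact: cont.
- by rewrite /psi scale0r addr0.
- by rewrite /phi gps_proj_id// /psi scale0r addr0.
- by move=> t t0; rewrite /eta addrC subrK.
- by move=> t t0; exact: gps_proj_orthant.
- by move=> t t0; rewrite ltey_eq (tvar_fin eta_pl).
exists F => //; split=> [t t0|].
  (* Off the boundary the cone is trivial, so the indicator is 1 wherever the slope is nonzero; the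
     remaining times are null. *)
  rewrite (ae_eq_integral (cst 1%E))//.
  - rewrite integral_cst// mul1e -(FT.2 _ t0).
    (* The mass of [[0, t]] is squeezed between those of []0, t]] and []-1, t]], both equal to
       [F t]. *)
    apply/eqP; rewrite eq_le; apply/andP; split.
      have -> : (F t)%:E = lsm F `]0, t].
        by rewrite lsm_oc// (tvar_fun0 FT) subr0.
      apply: le_measure; rewrite ?inE//.
      by apply: subset_itvr; rewrite bnd_simp.
    have -> : (F t)%:E = lsm F `](-1), t].
      by rewrite lsm_oc ?(FT.1 (-1)) ?subr0//; lra.
    apply: le_measure; rewrite ?inE//.
    by apply: subset_itvr; rewrite bnd_simp; lra.
  - apply/measurable_EFinP; apply: measurable_indic.
    exact: phi_bd_measurable.
  - apply: negligibleS (slope_null eta_pl FT) => s /not_implyP[].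
    rewrite /= in_itv/= => /andP[s0 _] ns; split=> //.
    by apply: zero_cone => // sb; apply: ns; rewrite indicE mem_set.
exists (driver eta); split.
- by move=> i; apply: measurable_funS (measurable_driver eta_pl i).
- apply: negligibleS (slope_null eta_pl FT) => s /not_implyP[s0 ns]; split=> //.
  apply: contrapT => v0; apply: ns.
  have n0 : 0 < enorm (slope eta s).
    by rewrite lt_neqAle enorm_ge0 andbT; apply/eqP => /esym/enorm_eq0.
  split; last by rewrite enormZ ?invr_ge0 ?enorm_ge0// mulVf// gt_eqF.
  by apply/(dconeP beta_01 beta_sum)/coneZ; [rewrite invr_ge0 ltW|exact: slope_cone].
- by move=> t t0 i; exact: (integral_driver eta_pl FT eta0).
Qed.

Lemma fluidE t : 0 <= t -> fluid beta nu ubar t = gps_proj beta (ubar + t *: nu).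
Proof.
move=> t0; rewrite /fluid /GPS_map; case: xgetP => [y -> [eta' sp]|no].
  exact: skorokhod_unique sp fluid_solution _ _.
by exfalso; apply: (no phi); exists eta; exact: fluid_solution.
Qed.

End Existence.

(** * The classes S(nu) *)

Section Classes.
Variables (R : realType) (J : nat) (beta : 'rV[R]_J).
Hypothesis beta_01 : forall i, 0 < beta 0 i < 1.
Hypothesis beta_sum : \sum_i beta 0 i = 1.
Variable nu : 'rV[R]_J.

Let b0 i : 0 < beta 0 i. Proof. by have /andP[] := beta_01 i. Qed.
Let b1 i : 0 < 1 - beta 0 i. Proof. by have /andP[_] := beta_01 i; rewrite subr_gt0. Qed.

Notation l := (lam beta nu).

(** If all excesses were negative, so would be their sum over the complement of a set attaining [l];
    but that sum is the total drift. *)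
Lemma exists_unconstrained : 0 <= \sum_j nu 0 j -> exists i, beta 0 i * l <= nu 0 i.
Proof.
move=> nu0; apply: contrapT => /forallNP none.
have [A nA lA] := lam_attained beta_01 beta_sum nu.
have lt : \sum_(i | i \notin A) (nu 0 i - beta 0 i * l) < 0.
  rewrite -oppr_gt0 -sumrN; have /existsP[k kA] := nA.
  rewrite (bigD1 k)//= ltr_pwDl//; first by rewrite oppr_gt0 subr_lt0 ltNge; exact/negP.
  by apply: sumr_ge0 => i _; rewrite oppr_ge0 subr_le0 ltW// ltNge; exact/negP.
by move: lt; rewrite sum_notin_lam// lA; lra.
Qed.

Section NonnegDrift.
Hypothesis nu0 : 0 <= \sum_j nu 0 j.

Lemma projE i : gps_proj beta nu 0 i = Num.max 0 (nu 0 i - beta 0 i * l).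
Proof. by rewrite /gps_proj (nonneg_shift_id _ nu0) mxE. Qed.

Lemma proj_nu_sum : \sum_i gps_proj beta nu 0 i = \sum_i nu 0 i.
Proof. by rewrite gps_proj_sum// max_r. Qed.

Let theta_spec (theta : {ffun option 'I_J -> R}) :=
  [/\ forall k, 0 <= theta k,
      GPS_proj beta nu = nu + \sum_k theta k *: dir beta k,
      pos_classes theta <> setT &
      pos_classes theta `<=` [set i | GPS_proj beta nu 0 i = 0]].

(** The total push [B] is forced to be [l]: summing coordinates kills the extra direction, a class
    with [b = 0] gives [B <= l], and an unconstrained class gives [B >= l]. The signs of the [b i]
    follow. *)
Lemma theta_spec_classes theta : theta_spec theta ->
  pos_classes theta = [set i | nu 0 i < beta 0 i * l].
Proof.
move=> [th0 thE thT _].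
pose b j := theta (Some j) / (1 - beta 0 j); pose B := \sum_i b i.
pose c := theta None / Num.sqrt J%:R.
have E j : gps_proj beta nu 0 j = nu 0 j + (b j - beta 0 j * B + c).
  by rewrite -GPS_projE// thE mxE (dir_sumE beta_01).
have b_ge0 j : 0 <= b j by rewrite divr_ge0 ?th0 ?ltW.
have c0 : c = 0.
  have := proj_nu_sum; rewrite (eq_bigr _ (fun j _ => E j)) big_split/=.
  rewrite sum_shift// -/B subrr add0r => /eqP; rewrite -subr_eq0 addrAC subrr add0r.
  by rewrite mulrn_eq0 gtn_eqF ?(classes_gt0 beta_sum)//= => /eqP.
have [i0 bi0] : exists i, b i = 0.
  apply: contrapT => /forallNP nb; apply: thT; apply/seteqP; split=> // i _.
  rewrite /pos_classes/= lt_neqAle th0 andbT eq_sym; apply/eqP => t0.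
  by apply: (nb i); rewrite /b t0 mul0r.
have [i1 hi1] := exists_unconstrained nu0.
have Bl : B = l.
  apply/eqP; rewrite eq_le; apply/andP; split.
    rewrite -(ler_pM2l (b0 i0)); have := E i0; rewrite projE bi0 c0 => e.
    have : nu 0 i0 - beta 0 i0 * l <= Num.max 0 (nu 0 i0 - beta 0 i0 * l).
      by rewrite le_max lexx orbT.
    by rewrite e; lra.
  rewrite -(ler_pM2l (b0 i1)); have := E i1; rewrite projE max_r ?subr_ge0// c0.
  by have := b_ge0 i1; lra.
apply/seteqP; split=> i /=; rewrite /pos_classes/=.
  move=> ti; have bi : 0 < b i by rewrite divr_gt0.
  have := E i; rewrite projE c0 Bl; case: (leP 0) => h e; lra.
move=> ni; suff : 0 < b i by rewrite /b pmulr_lgt0// invr_gt0.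
by have := E i; rewrite projE c0 Bl max_l; lra.
Qed.

(** The deficits [b j] have total [l]; the factor [1 - beta_j] undoes the normalization of [dir]. *)
Lemma theta_spec_exists : exists theta, theta_spec theta.
Proof.
pose b j := Num.max 0 (beta 0 j * l - nu 0 j).
have bE j : b j = gps_proj beta nu 0 j - nu 0 j + beta 0 j * l.
  rewrite projE /b; have [h|h] := leP (nu 0 j) (beta 0 j * l).
    by rewrite max_r ?subr_ge0// max_l ?subr_le0//; lra.
  by rewrite max_l ?subr_le0 ?ltW// max_r ?subr_ge0 ?ltW//; lra.
exists [ffun k => if k is Some i then (1 - beta 0 i) * b i else 0]; split.
- by move=> [i|]; rewrite ffunE// mulr_ge0 ?(ltW (b1 _))// le_max lexx.
- rewrite GPS_projE//; apply/rowP => j; rewrite [in RHS]mxE (dir_sumE beta_01) !ffunE.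
  under eq_bigr do rewrite ffunE mulrAC divff ?gt_eqF// mul1r bE.
  rewrite mulrAC divff ?gt_eqF// mul1r bE mul0r addr0 big_split/= sumrB proj_nu_sum.
  by rewrite subrr add0r -mulr_suml beta_sum mul1r; ring.
- have [i1 hi1] := exists_unconstrained nu0.
  move=> /seteqP[_ /(_ i1 I)]; rewrite /pos_classes/= ffunE.
  by rewrite pmulr_rgt0// lt_max ltxx/= subr_gt0 ltNge hi1.
- move=> i; rewrite /pos_classes/= ffunE pmulr_rgt0// lt_max ltxx/= subr_gt0 => ni.
  by rewrite GPS_projE// projE max_l// subr_le0 ltW.
Qed.

Lemma calSE : calS beta nu = [set i | nu 0 i < beta 0 i * l].
Proof.
rewrite /calS ltNge nu0/= /theta_of; case: xgetP => [theta -> H|no].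
  exact: theta_spec_classes.
by have [theta H] := theta_spec_exists; case: (no theta).
Qed.

End NonnegDrift.

Lemma calS_neg : \sum_j nu 0 j < 0 -> calS beta nu = setT.
Proof. by rewrite /calS => ->. Qed.

Lemma proj_nonpos (x : 'rV[R]_J) : \sum_j x 0 j <= 0 -> gps_proj beta x = 0.
Proof.
move=> x0; apply: row_sum_eq0; first exact: gps_proj_orthant.
by rewrite gps_proj_sum// max_l.
Qed.

Lemma proj_calS i : calS beta nu i -> gps_proj beta nu 0 i = 0.
Proof.
have [n0|n0] := ltP (\sum_j nu 0 j) 0; first by rewrite proj_nonpos ?mxE// ltW.
by rewrite calSE//= projE// => ni; rewrite max_l// subr_le0 ltW.
Qed.

Lemma calM_ray ubar t : calM beta nu ubar -> 0 <= t ->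
  calM beta nu (ubar + t *: gps_proj beta nu).
Proof.
have E i : (ubar + t *: gps_proj beta nu) 0 i = ubar 0 i + t * gps_proj beta nu 0 i.
  by rewrite mxE; congr (_ + _); rewrite mxE.
move=> [u0 uS] t0; split=> i; rewrite E.
  by rewrite addr_ge0 ?mulr_ge0 ?u0 ?gps_proj_orthant.
by move=> Si; rewrite uS// proj_calS// mulr0 addr0.
Qed.

(** By uniqueness it is enough to certify the right side. With negative total drift it is the
    origin; otherwise a class positive there is outside S(nu), so its ratio is [- l], the least
    possible. *)
Lemma proj_ray ubar t : calM beta nu ubar -> 0 <= t ->
  gps_proj beta (ubar + t *: nu) = ubar + t *: gps_proj beta nu.
Proof.
move=> Mu t0; have [yo _] := calM_ray Mu t0; case: (Mu) => [u0 uS].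
apply/esym/gps_projP => //.
have -> : ubar + t *: gps_proj beta nu - (ubar + t *: nu) = t *: (gps_proj beta nu - nu).
  by rewrite opprD addrACA subrr add0r -scalerBr.
apply: coneZ => //; have [n0|n0] := ltP (\sum_j nu 0 j) 0.
  have -> : ubar = 0 by apply/rowP => i; rewrite uS ?mxE// calS_neg.
  rewrite proj_nonpos ?(ltW n0)// scaler0 add0r sub0r /cone eqxx.
  under eq_bigr do rewrite mxE.
  by rewrite sumrN oppr_ge0 ltW.
have wE i : (gps_proj beta nu - nu) 0 i = gps_proj beta nu 0 i - nu 0 i by rewrite !mxE.
rewrite /cone; under eq_bigr do rewrite wE.
rewrite sumrB proj_nu_sum// subrr; case: ifP => // _; split=> // i j.
rewrite !wE => yi; have ni : beta 0 i * l <= nu 0 i.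
  rewrite leNgt; apply: contra yi => ni; have Si : calS beta nu i by rewrite calSE.
  by rewrite mxE [X in _ + X]mxE uS// proj_calS// mulr0 addr0.
rewrite !projE// max_r ?subr_ge0//.
have -> : (nu 0 i - beta 0 i * l - nu 0 i) / beta 0 i = - l by field; rewrite gt_eqF.
by rewrite ler_pdivlMr// lerBrDr le_max; apply/orP; right; lra.
Qed.

Lemma coord_le_norm (x : 'rV[R]_J) i : `|x 0 i| <= `|x|.
Proof. by rewrite -[`|x|]/(mx_norm x) mx_normrE (le_bigmax _ _ (0, i)). Qed.

(** With coordinates bounded by [K], a negative total drift brings the sum below 0. Otherwise a set
    attaining [lam] at nu gives [lam (u + t nu) >= t l - J K / m], and this outgrows [u_i + t nu_i]
    for each class of S(nu), once multiplied by [beta_i]. *)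
Lemma absorption (G : set 'rV[R]_J) : compact G -> G `<=` @orthant R J ->
  exists2 T : R, 0 <= T & forall ubar, G ubar -> forall t, T <= t ->
    calM beta nu (gps_proj beta (ubar + t *: nu)).
Proof.
move=> cG G0; have [K K0 GK] := pinfty_ex_gt0 (compact_bounded cG).
have {}GK u i : G u -> u 0 i <= K.
  by move=> /GK; apply: le_trans; apply: le_trans (ler_norm _) (coord_le_norm _ _).
have sumK (P : pred 'I_J) u : G u -> \sum_(i | P i) u 0 i <= J%:R * K.
  move=> Gu; rewrite mulr_natl -[in leRHS](card_ord J) -sumr_const.
  rewrite [leRHS](bigID P)/= -[leLHS]addr0 lerD ?ler_sum ?sumr_ge0// => i _.
    exact: GK.
  exact: ltW.
have [n0|n0] := ltP (\sum_j nu 0 j) 0.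
  exists (J%:R * K / - \sum_j nu 0 j) => [|u Gu t].
    by rewrite divr_ge0 ?oppr_ge0 ?(ltW n0) ?mulr_ge0 ?(ltW K0).
  rewrite ler_pdivrMr ?oppr_gt0// => tT; rewrite proj_nonpos.
    by split=> [i|i _]; rewrite mxE ?lexx.
  have -> : \sum_j (u + t *: nu) 0 j = \sum_j u 0 j + t * \sum_j nu 0 j.
    by rewrite mulr_sumr -big_split/=; apply: eq_bigr => j _; rewrite !mxE.
  by have := sumK xpredT u Gu; lra.
have [A nA lA] := lam_attained beta_01 beta_sum nu.
set m := 1 - _ in lA; have m0 : 0 < m by exact: proper_mass.
(* The time by which that bound on the excess of class i reaches 0. The sum of these nonnegative
   times dominates each of them. *)
pose T i := (K + beta 0 i * (J%:R * K / m)) / (beta 0 i * l - nu 0 i).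
have num0 i : 0 <= K + beta 0 i * (J%:R * K / m).
  apply: addr_ge0; first exact: ltW.
  by rewrite !mulr_ge0 ?invr_ge0 ?(ltW K0) ?(ltW m0) ?(ltW (b0 _)).
have T0 i : nu 0 i < beta 0 i * l -> 0 <= T i.
  by move=> ni; rewrite divr_ge0// subr_ge0 ltW.
exists (\sum_(i | nu 0 i < beta 0 i * l) T i) => [|u Gu t tT]; first exact: sumr_ge0.
have t0 : 0 <= t by apply: le_trans tT; exact: sumr_ge0.
split; first exact: gps_proj_orthant.
move=> i; rewrite calSE//= => ni.
have tTi : T i <= t.
  by apply: le_trans tT; rewrite (bigD1 i)//= lerDl sumr_ge0// => j /andP[/T0].
have s0 : 0 <= \sum_j (u + t *: nu) 0 j.
  have -> : \sum_j (u + t *: nu) 0 j = \sum_j u 0 j + t * \sum_j nu 0 j.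
    by rewrite mulr_sumr -big_split/=; apply: eq_bigr => j _; rewrite !mxE.
  by rewrite addr_ge0 ?mulr_ge0// sumr_ge0// => j _; exact: G0.
rewrite /gps_proj nonneg_shift_id// mxE max_l// subr_le0.
have : t * l - J%:R * K / m <= lam beta (u + t *: nu).
  rewrite -(ler_pM2r m0) mulrBl divfK ?gt_eqF// -mulrA lA.
  apply: le_trans (lam_ge beta_01 beta_sum (u + t *: nu) nA).
  have -> : \sum_(j in A) (u + t *: nu) 0 j =
      \sum_(j in A) u 0 j + t * \sum_(j in A) nu 0 j.
    by rewrite mulr_sumr -big_split/=; apply: eq_bigr => j _; rewrite !mxE.
  by have := sumK (fun j => j \in A) u Gu; lra.
move=> ll; apply: le_trans (_ : beta 0 i * (t * l - J%:R * K / m) <= _); last first.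
  by rewrite ler_wpM2l// ltW.
move: tTi; rewrite /T ler_pdivrMr ?subr_gt0// !mxE; have := GK _ i Gu.
by move: (J%:R * K / m) => q; lra.
Qed.

End Classes.

Theorem theorem4p6 (R : realType) (J : nat) (hJ : (1 < J)%N) (beta : 'rV[R]_J)
    (beta_01 : forall i, 0 < beta 0 i < 1) (beta_sum : \sum_i beta 0 i = 1)
    (nu : 'rV[R]_J) :
  let kappa := GPS_proj beta nu in
  let S := calS beta nu in
  let M := calM beta nu in
  let U := fluid beta nu in
  let i1 : 'I_J := Ordinal (ltnW hJ) in
  [/\ (* (i) *)
      forall ubar, M ubar -> forall t : R, 0 < t ->
        U ubar t = ubar + t *: kappa /\ M (U ubar t),
      (* (ii) *)
      forall G : set 'rV[R]_J, compact G -> G `<=` @orthant R J ->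
        exists2 T : R, 0 <= T &
          forall ubar, G ubar -> forall t : R, T <= t -> M (U ubar t),
      (* (iii) *)
      exists2 ubar, M ubar &
        forall t : R, 0 < t -> forall i, ~ S i -> 0 < U ubar t 0 i,
      (* (iv) *)
      \sum_j nu 0 j <= 0 ->
        M = [set ubar | orthant ubar /\ forall t : R, 0 <= t -> U ubar t = ubar] &
      (* (v) *)
      (forall i j : 'I_J, (i <= j)%N ->
         nu 0 j / beta 0 j <= nu 0 i / beta 0 i) ->
      \sum_j nu 0 j = 0 ->
      \big[Num.min/nu 0 i1]_j nu 0 j < 0 ->
      (exists jstar : 'I_J,
         (forall j : 'I_J, (j < jstar)%N ->
            nu 0 j / beta 0 j = nu 0 i1 / beta 0 i1) /\
         S = [set j | nu 0 j / beta 0 j < nu 0 i1 / beta 0 i1]) /\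
      (forall j, ~ S j ->
         nu 0 j = - beta 0 j * (\sum_(k in S) nu 0 k) /
                  (1 - \sum_(k in S) beta 0 k))].
Proof.
move=> kappa S M U i1.
have fE u t : M u \/ orthant u -> 0 <= t -> U u t = gps_proj beta (u + t *: nu).
  by move=> Mu t0; apply: fluidE => //; case: Mu => // -[].
have ray u t : M u -> 0 <= t -> U u t = u + t *: kappa.
  by move=> Mu t0; rewrite fE//; [rewrite proj_ray// /kappa GPS_projE|left].
have Mray u t : M u -> 0 <= t -> M (u + t *: kappa).
  by move=> Mu t0; rewrite /kappa GPS_projE//; exact: calM_ray.
have absorb : forall G : set 'rV[R]_J, compact G -> G `<=` @orthant R J ->
    exists2 T : R, 0 <= T &
      forall ubar, G ubar -> forall t : R, T <= t -> M (U ubar t).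
  move=> G cG G0; have [T T0 H] := absorption beta_01 beta_sum nu cG G0.
  exists T => // u Gu t Tt; rewrite fE; first exact: H.
    by right; exact: G0.
  exact: le_trans Tt.
split=> //.
- by move=> u Mu t t0; rewrite ray ?(ltW t0)//; split=> //; exact/Mray/ltW.
(* Off S every coordinate starts at 1, and kappa, lying in the orthant, cannot decrease it. *)
- pose u : 'rV[R]_J := \row_i (if asbool (S i) then 0 else 1).
  have Mu : M u.
    split=> i; rewrite mxE; first by case: ifP.
    by move=> Si; rewrite asboolT.
  exists u => // t t0 i nS; rewrite ray ?(ltW t0)// mxE mxE asboolF//.
  rewrite ltr_pwDl// mxE mulr_ge0 ?(ltW t0)// /kappa GPS_projE//.
  exact: gps_proj_orthant.
- move=> nu0; have k0 : kappa = 0 by rewrite /kappa GPS_projE// proj_nonpos.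
  apply/seteqP; split=> u /=.
    by move=> Mu; split=> [|t t0]; [case: Mu|rewrite ray// k0 scaler0 addr0].
  move=> [u0 uE].
  (* A path that never moves is, at the absorption time of its own singleton, still at [u]. *)
  have [|T T0 H] := absorb [set u] (@compact_set1 _ u); first by move=> _ ->.
  by rewrite -(uE T T0); exact: H.
- move=> mono nu0 min_neg; have nu_ge0 : 0 <= \sum_j nu 0 j by rewrite nu0.
  have b0 i : 0 < beta 0 i by have /andP[] := beta_01 i.
  set l := lam beta nu; have SE : S = [set i | nu 0 i < beta 0 i * l] by exact: calSE.
  (* With total drift 0 the projection of nu is the origin, so no excess is positive. *)
  have le_l i : nu 0 i <= beta 0 i * l.
    have : gps_proj beta nu 0 i = 0 by rewrite proj_nonpos ?nu0// mxE.
    by rewrite projE// => /max_idPl; rewrite subr_le0.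
  have nSE i : ~ S i -> nu 0 i = beta 0 i * l.
    by rewrite SE /= => /negP; rewrite -leNgt => h; apply/eqP; rewrite eq_le le_l.
  have [i0 hi0] := exists_unconstrained beta_01 beta_sum nu_ge0.
  (* [l] bounds every ratio, and the ratio of an unconstrained class is at least [l]; by the
     ordering so is that of the first class. *)
  have lE : l = nu 0 i1 / beta 0 i1.
    apply/eqP; rewrite eq_le; apply/andP; split.
      by apply: le_trans (mono i1 i0 _) => //; rewrite ler_pdivlMr// mulrC.
    by rewrite ler_pdivrMr// mulrC le_l.
  have SE' : S = [set j | nu 0 j / beta 0 j < nu 0 i1 / beta 0 i1].
    by rewrite SE; apply/seteqP; split=> j; rewrite /= -lE ltr_pdivrMr// mulrC.
  split.
    (* Were S empty, each drift would be [beta_i l >= 0], against the negative minimum. The index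
       [jstar] is then the least element of S. *)
    have [k Sk] : exists k, S k.
      apply: contrapT => /forallNP nS; move: min_neg; apply/negP; rewrite -leNgt.
      have nn i : 0 <= nu 0 i by rewrite (nSE _ (nS i)) mulr_ge0 ?lam_ge0// ltW.
      by apply: le_bigmin.
    case: (@arg_minnP _ k (fun j => `[< S j >]) (fun j => j : nat)) => [|j Sj jmin].
      exact/asboolP.
    exists j; split=> // i ij; rewrite nSE => [|/asboolP/jmin]; last by rewrite leqNgt ij.
    by rewrite mulrAC divff ?mul1r ?gt_eqF.
  move=> j nSj; rewrite (nSE _ nSj).
  have mE : 1 - \sum_(k in S) beta 0 k = \sum_(k | k \notin S) beta 0 k.
    by rewrite -beta_sum (bigID (fun k => k \in S))/= addrAC subrr add0r.
  (* The drifts off S are [beta_k l], and those on S balance them. *)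
  have nuE : \sum_(k in S) nu 0 k = - (l * \sum_(k | k \notin S) beta 0 k).
    have E : \sum_(k | k \notin S) nu 0 k = l * \sum_(k | k \notin S) beta 0 k.
      by rewrite mulr_sumr; apply: eq_bigr => k; rewrite notin_setE mulrC; exact: nSE.
    by move: nu0; rewrite (bigID (fun k => k \in S))/= E; lra.
  have m0 : \sum_(k | k \notin S) beta 0 k != 0.
    rewrite gt_eqF// (bigD1 j) ?notin_setE//= ltr_pwDl// sumr_ge0// => k _.
    exact: ltW.
  by rewrite mE nuE; field.
Qed.
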